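(* Let $t,A,B,u_1,u_2,\dots,w_1,w_2,\dots$ be independent indeterminates over $\mathbb{C}$. Let $N,n\ge1$ and $0\le m\le\min(n,N)$ be integers and $1\le x_1<\cdots<x_m\le N$ integers; when $m=0$ the condition ''$x_m\ne N$'' is regarded as satisfied. The wavefunctions with triangular boundary $W_{N,n,m}(u_1,\dots,u_n|w_1,\dots,w_N|x_1,\dots,x_m)$ (defined in the context) satisfy the following properties. (1) $W_{N,n,m}(u_1,\dots,u_n|w_1,\dots,w_N|x_1,\dots,x_m)$ is a polynomial in $w_N$, of degree $n-1$ if $x_m=N$ and of degree $n$ if $x_m\neq N$. (2) $W_{N,n,m}(u_1,\dots,u_n|w_1,\dots,w_N|x_1,\dots,x_m)$ is symmetric with respect to $u_1,\dots,u_n$. (3) Let $N\ge2$. If $x_m=N$, then \begin{align*} &W_{N,n,m}(u_1,\dots,u_n|w_1,\dots,w_N|x_1,\dots,x_m)|_{w_N=t^{-1}u_n}\\ =&(1-t)\prod_{j=1}^{n-1}(tu_j-u_n)\prod_{j=1}^n(u_ju_n-1)\prod_{j=1}^{N-1}(u_n-w_j)\\ &\times W_{N-1,n-1,m-1}(u_1,\dots,u_{n-1}|w_1,\dots,w_{N-1}|x_1,\dots,x_{m-1}). \end{align*} If $x_m\neq N$, then $$W_{N,n,m}(u_1,\dots,u_n|w_1,\dots,w_N|x_1,\dots,x_m)=\prod_{j=1}^n(u_j-tw_N)\;W_{N-1,n,m}(u_1,\dots,u_n|w_1,\dots,w_{N-1}|x_1,\dots,x_m).$$ (4) For $N=m=1$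 (writing $w=w_1$), $$W_{1,n,1}(u_1,\dots,u_n|w|1)|_{w=t^{-1}u_n}=(1-t)\prod_{j=1}^{n-1}(tu_j-u_n)(Bu_j-A)\prod_{j=1}^n(u_ju_n-1)\prod_{1\le j<k\le n-1}(u_ju_k-t),$$ and for $N=1$, $m=0$, $$W_{1,n,0}(u_1,\dots,u_n|w)=\prod_{j=1}^n(Bu_j-A)\prod_{j=1}^n(u_j-tw)\prod_{1\le j<k\le n}(u_ju_k-t).$$
   Context: All vector spaces and operators are over the field of rational functions in the indeterminates. Each space $W_a$ is two-dimensional with basis $|0\rangle_a,|1\rangle_a$ and dual basis ${}_a\langle 0|,{}_a\langle 1|$. $R$-matrix: $R_{ab}(u,w)$ acts on $W_a\otimes W_b$. Writing $[\gamma\delta|\alpha\beta]={}_a\langle\gamma|{}_b\langle\delta|R_{ab}(u,w)|\alpha\rangle_a|\beta\rangle_b$, its nonzero matrix elements are $[00|00]=[11|11]=u-tw$, $[01|01]=t(u-w)$, $[01|10]=(1-t)u$, $[10|01]=(1-t)w$, $[10|10]=u-w$; all others are $0$. $K$-matrix: $K_a(u)$ acts on $W_a$ with matrix elements ${}_a\langle 0|K_a(u)|0\rangle_a=Bu-A$, ${}_a\langle 0|K_a(u)|1\rangle_a=0$, ${}_a\langle 1|K_a(u)|0\rangle_a=u-u^{-1}$, ${}_a\langle 1|K_a(u)|1\rangle_a=Bu^{-1}-A$. Operators act on $W_{-n}\otimes\cdots\otimes W_{-1}\otimes W_1\otimes\cdots\otimes W_N$ (there is no $W_0$), as the identity on the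 factors not indicated by the subscripts. For $j=1,\dots,n$ define $$T_j(u_1,\dots,u_j|w_1,\dots,w_N)=R_{-j,N}(u_j,w_N)\cdots R_{-j,1}(u_j,w_1)\,R_{-j,-1}(u_ju_1,1)\,R_{-j,-2}(u_ju_2,1)\cdots R_{-j,-j+1}(u_ju_{j-1},1)\,K_{-j}(u_j)$$ (for $j=1$ there are no factors $R_{-j,-i}$). Let $\langle 0^n|={}_{-n}\langle 0|\otimes\cdots\otimes{}_{-1}\langle 0|$ and $|\Omega\rangle_{n+N}=|0\rangle_{-n}\otimes\cdots\otimes|0\rangle_{-1}\otimes|0\rangle_1\otimes\cdots\otimes|0\rangle_N$. Define the vector in $W_1\otimes\cdots\otimes W_N$ $$|\Psi_{N,n}(u_1,\dots,u_n|w_1,\dots,w_N)\rangle=\langle 0^n|\,T_1(u_1|w_1,\dots,w_N)\,T_2(u_1,u_2|w_1,\dots,w_N)\cdots T_n(u_1,\dots,u_n|w_1,\dots,w_N)\,|\Omega\rangle_{n+N}$$ (partial contraction with $\langle 0^n|$ on $W_{-n}\otimes\cdots\otimes W_{-1}$). For $1\le x_1<\cdots<x_m\le N$, let $\langle x_1\cdots x_m|\in W_1^*\otimes\cdots\otimes W_N^*$ be the tensor product of ${}_k\langle 1|$ for $k\in\{x_1,\dots,x_m\}$ and ${}_k\langle 0|$ for the other $k\in\{1,\dots,N\}$. The wavefunction with triangular boundary is $$W_{N,n,m}(u_1,\dots,u_n|w_1,\dots,w_N|x_1,\dots,x_m)=\langle x_1\cdots x_m|\Psi_{N,n}(u_1,\dots,u_n|w_1,\dots,w_N)\rangle.$$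 For $n=0$ the product of the $T_j$ is empty, so $W_{N,0,0}=1$. Empty products equal $1$. The degree in $w_N$ is taken with coefficients in the field of rational functions in the remaining indeterminates. *)

(* Defs.v *)
From HB Require Import structures.
From mathcomp Require Import all_boot all_order all_algebra.
From mathcomp Require Import reals complex mpoly.

Set Implicit Arguments.
Unset Strict Implicit.
Unset Printing Implicit Defensive.

Import GRing.Theory.
Local Open Scope ring_scope.

(* For given n and N only the indeterminates
     t, A, B, u_1, ..., u_n, w_1, ..., w_N
   of the infinite list t, A, B, u_1, u_2, ..., w_1, w_2, ... occur.  They are
   numbered 0, ..., n + N + 2, in this order. *)
Notation nvars n N := (n + N).+3 (only parsing).

Section RationalFunctions.
Variables (R : realType) (l : nat).

Definition ratfun : fieldType := {fraction {mpoly R[i][l]}}.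

Definition constC (c : R[i]) : ratfun := tofrac (mpolyC l c).
Definition var (k : 'I_l) : ratfun := tofrac ('X_k : {mpoly R[i][l]}).

Definition mpoly_free_of (k : 'I_l) (a : {mpoly R[i][l]}) : Prop :=
  forall mon, mon \in msupp a -> mon k = 0%N.

Definition ratfun_free_of (k : 'I_l) (f : ratfun) : Prop :=
  exists a b : {mpoly R[i][l]},
    [/\ mpoly_free_of k a, mpoly_free_of k b, b != 0 & f = tofrac a / tofrac b].

(* As the k-th indeterminate is transcendental over the field of rational
   functions in the others, the polynomial p below is unique. *)
Definition polynomial_of_degree (k : 'I_l) (d : nat) (f : ratfun) : Prop :=
  exists p : {poly ratfun},
    [/\ forall i, ratfun_free_of k p`_i, size p = d.+1 & f = p.[var k]].

Definition mpoly_subst (k : 'I_l) (c : ratfun) (a : {mpoly R[i][l]}) : ratfun :=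
  mmap constC (fun i => if i == k then c else var i) a.

(* f|_{X_k = c} = v: f has a fraction representation whose denominator does not
   vanish at X_k = c.  The value v does not depend on the representation. *)
Definition subst_eq (f : ratfun) (k : 'I_l) (c v : ratfun) : Prop :=
  exists a b : {mpoly R[i][l]},
    [/\ mpoly_subst k c b != 0, f = tofrac a / tofrac b
      & v = mpoly_subst k c a / mpoly_subst k c b].

End RationalFunctions.

Section Indeterminates.
Variables (R : realType) (n N : nat).

(* The sequences of u's and w's start at index 1; uvar j and wvar k are
   meaningful only for 1 <= j <= n and 1 <= k <= N. *)
Definition w_index (k : nat) : 'I_(nvars n N) := inord (n + k + 2).

Definition tvar : ratfun R (nvars n N) := var R (inord 0).
Definition Avar : ratfun R (nvars n N) := var R (inord 1).
Definition Bvar : ratfun R (nvars n N) := var R (inord 2).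
Definition uvar (j : nat) : ratfun R (nvars n N) := var R (inord (j + 2)).
Definition wvar (k : nat) : ratfun R (nvars n N) := var R (w_index k).

End Indeterminates.

Section Wavefunction.
Variables (F : fieldType) (t A B : F).

(* The indices 0 and 1 of the basis vectors of a two-dimensional space are
   encoded as false and true. *)

(* Rentry u w g d a b = [g d | a b] *)
Definition Rentry (u w : F) (g d a b : bool) : F :=
  match g, d, a, b with
  | false, false, false, false => u - t * w
  | true,  true,  true,  true  => u - t * w
  | false, true,  false, true  => t * (u - w)
  | false, true,  true,  false => (1 - t) * u
  | true,  false, false, true  => (1 - t) * w
  | true,  false, true,  false => u - w
  | _, _, _, _ => 0
  end.

(* Kentry u g a = <g| K(u) |a> *)
Definition Kentry (u : F) (g a : bool) : F :=
  match g, a with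
  | false, false => B * u - A
  | false, true  => 0
  | true,  false => u - u^-1
  | true,  true  => B * u^-1 - A
  end.

(* The tensor product of two-dimensional spaces indexed by a finite type S is
   the space of families of coordinates in the tensor basis, itself indexed by
   {ffun S -> bool}. *)
Definition tensor (S : finType) := {ffun {ffun S -> bool} -> F}.

Definition upd (S : finType) (c : {ffun S -> bool}) (s : S) (b : bool) :
    {ffun S -> bool} :=
  [ffun r => if r == s then b else c r].

Definition Rop (S : finType) (a b : S) (u w : F) (v : tensor S) : tensor S :=
  [ffun c : {ffun S -> bool} =>
     \sum_(alpha : bool) \sum_(beta : bool)
       Rentry u w (c a) (c b) alpha beta * v (upd (upd c a alpha) b beta)].

Definition Kop (S : finType) (a : S) (u : F) (v : tensor S) : tensor S :=
  [ffun c : {ffun S -> bool} =>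
     \sum_(alpha : bool) Kentry u (c a) alpha * v (upd c a alpha)].

(* The composite f_1 f_2 ... f_k of [:: f_1; f_2; ...; f_k]; f_k acts first. *)
Definition op_prod (V : Type) (fs : seq (V -> V)) : V -> V :=
  foldr (fun f g => f \o g) id fs.

(* Since ordinals start at 0, the space W_{-j} is indexed by inl i with
   i = j - 1, and W_k by inr i with i = k - 1. *)
Definition site (N n : nat) : finType := ('I_n + 'I_N)%type.

Definition Top (N n : nat) (u w : nat -> F) (j : 'I_n) :
    tensor (site N n) -> tensor (site N n) :=
  let neg (i : 'I_n) : site N n := inl i in
  let pos (k : 'I_N) : site N n := inr k in
  op_prod ([seq Rop (neg j) (pos k) (u j.+1) (w k.+1) | k : 'I_N <- rev (enum 'I_N)]
        ++ [seq Rop (neg j) (neg i) (u j.+1 * u i.+1) 1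
              | i : 'I_n <- enum 'I_n & (i < j)%N]
        ++ [:: Kop (neg j) (u j.+1)]).

Definition Omega (S : finType) : tensor S :=
  [ffun c : {ffun S -> bool} => (c == [ffun => false])%:R].

Definition contract0 (N n : nat) (v : tensor (site N n)) : tensor 'I_N :=
  [ffun c : {ffun 'I_N -> bool} =>
     v [ffun s : site N n => match s with inl _ => false | inr k => c k end]].

Definition Psi (N n : nat) (u w : nat -> F) : tensor 'I_N :=
  contract0 (op_prod [seq @Top N n u w j | j <- enum 'I_n] (Omega (site N n))).

(* u and w are indexed from 1; x is the list of positions x_1, ..., x_m.  *)
Definition wavefunction (N n : nat) (u w : nat -> F) (x : seq nat) : F :=
  Psi N n u w [ffun k : 'I_N => k.+1 \in x].

End Wavefunction.

(* Main.v *)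
(* Symmetry: multiplied by the flip, R_{-j,-j-1}(u_j,u_{j+1}) exchanges u_j and
   u_{j+1} in every factor: in the pair T_j T_{j+1} by the Yang-Baxter and the
   reflection equation, in T_k with k > j+1 by the Yang-Baxter equation, while it
   commutes with the earlier factors.  Both <0^n| and |Omega> are eigenvectors
   with eigenvalue u_j - t u_{j+1}, which is not 0.

   Recursion: every line leaves in state 0, so the site N can only be turned from
   0 to 1, once.  If x_m <> N it stays 0 and each T_j contributes u_j - t w_N.
   If x_m = N and t w_N = u_n, the weight u_n - t w_N vanishes, so already the line
   of T_n must carry its particle through all other sites to the site N; the later
   lines meet a full site and contribute t (u_j - w_N).

   Degree: the line which fills the site N contributes a factor independent of
   w_N, every other line a factor u_j - t w_N or t (u_j - w_N), so all terms have
   leading coefficients of the same sign wherever the weights are nonnegative.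
   At t = 1/2, A = -1, B = 0, u_j = 2, w_k = 1 the weights that can occur are
   positive, and the configurations in which the line of T_j deposits a particle
   at x_j for j <= m give a nonzero contribution. *)

From HB Require Import structures.
Require Import Defs.
From mathcomp Require Import all_boot all_order all_algebra.
From mathcomp Require Import reals complex mpoly.
From mathcomp Require Import ring zify.

Set Implicit Arguments.
Unset Strict Implicit.
Unset Printing Implicit Defensive.

Import GRing.Theory.
Local Open Scope ring_scope.

(** * Braid relations *)

Section Updates.
Variable S : finType.
Implicit Types (a b : S) (c : {ffun S -> bool}) (x y : bool).

Lemma updE c a x b : upd c a x b = if b == a then x else c b.
Proof. by rewrite ffunE. Qed.

Lemma upd_eq c a x : upd c a x a = x.
Proof. by rewrite updE eqxx. Qed.

Lemma upd_neq c a b x : b != a -> upd c a x b = c b.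
Proof. by rewrite updE => /negPf ->. Qed.

Lemma upd_upd c a x y : upd (upd c a x) a y = upd c a y.
Proof. by apply/ffunP => r; rewrite !updE; case: eqP. Qed.

Lemma updC c a b x y : a != b -> upd (upd c b y) a x = upd (upd c a x) b y.
Proof.
move=> ab; apply/ffunP => r; rewrite !updE.
by case: (eqVneq r a) => // ->; rewrite (negPf ab).
Qed.

Lemma upd_id c a : upd c a (c a) = c.
Proof. by apply/ffunP => r; rewrite !updE; case: eqP => // ->. Qed.

Lemma upd_same c a x : c a = x -> upd c a x = c.
Proof. by move=> <-; apply: upd_id. Qed.

End Updates.
Arguments updC {S} c {a b} x y.

Section LocalOperators.
Variables (F : fieldType) (t A B : F) (S : finType).
Implicit Types (a b s d : S) (u v w : F) (x : tensor F S) (c : {ffun S -> bool}).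

Definition op2 a b (M : bool -> bool -> bool -> bool -> F) x : tensor F S :=
  [ffun c : {ffun S -> bool} =>
     \sum_(alpha : bool) \sum_(beta : bool)
       M (c a) (c b) alpha beta * x (upd (upd c a alpha) b beta)].

Lemma op2E a b M x c :
  op2 a b M x c =
    M (c a) (c b) true true * x (upd (upd c a true) b true)
    + M (c a) (c b) true false * x (upd (upd c a true) b false)
    + (M (c a) (c b) false true * x (upd (upd c a false) b true)
       + M (c a) (c b) false false * x (upd (upd c a false) b false)).
Proof. by rewrite ffunE !big_bool. Qed.

Lemma RopE a b u w : Rop t a b u w = op2 a b (Rentry t u w).
Proof. by []. Qed.

Lemma KopE a u x c :
  Kop A B a u x c = Kentry A B u (c a) true * x (upd c a true)
                    + Kentry A B u (c a) false * x (upd c a false).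
Proof. by rewrite ffunE big_bool. Qed.

Lemma op2_op2C a b s d M M' x :
  a != s -> a != d -> b != s -> b != d ->
  op2 a b M (op2 s d M' x) = op2 s d M' (op2 a b M x).
Proof.
move=> as_ ad bs bd; apply/ffunP => c.
have [sa da sb db] : [/\ s != a, d != a, s != b & d != b] by rewrite !(eq_sym _ a) !(eq_sym _ b).
rewrite !op2E !(updE, eqxx, negPf as_, negPf ad, negPf bs, negPf bd,
  negPf sa, negPf da, negPf sb, negPf db).
rewrite !(updC _ _ _ as_, updC _ _ _ ad, updC _ _ _ bs, updC _ _ _ bd).
ring.
Qed.

Lemma Kop_op2C a s d u M x :
  a != s -> a != d -> Kop A B a u (op2 s d M x) = op2 s d M (Kop A B a u x).
Proof.
move=> as_ ad; apply/ffunP => c.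
have [sa da] : s != a /\ d != a by rewrite !(eq_sym _ a).
rewrite !(op2E, KopE) !(updE, eqxx, negPf as_, negPf ad, negPf sa, negPf da).
rewrite !(updC _ _ _ as_, updC _ _ _ ad).
ring.
Qed.


(** A row of the R-matrix paired with incoming amplitudes [g], with the ten vanishing entries left
    out; this keeps the case analyses below small. *)
Definition Rrow u w (g : bool -> bool -> F) (al be : bool) : F :=
  match al, be with
  | false, false => (u - t * w) * g false false
  | true, true => (u - t * w) * g true true
  | false, true => t * (u - w) * g false true + (1 - t) * u * g true false
  | true, false => (1 - t) * w * g false true + (u - w) * g true false
  end.

Lemma RopRow a b u w x c :
  Rop t a b u w x c
  = Rrow u w (fun al be => x (upd (upd c a al) b be)) (c a) (c b).
Proof.
by rewrite RopE op2E; case: (c a) (c b) => [] [] /=; rewrite !mul0r ?add0r ?addr0 // addrC.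
Qed.

(* Two-site operators which exchange the parameters u and v of the lines
   crossing a and b: both are an R-matrix followed by the flip of the factors. *)
Definition braid a b u v :=
  op2 a b (fun ga de al be : bool => Rentry t u v de ga al be).
Definition braid' a b u v :=
  op2 a b (fun ga de al be : bool => Rentry t u v ga de be al).

Lemma braidRow a b u v x c :
  braid a b u v x c
  = Rrow u v (fun al be => x (upd (upd c a al) b be)) (c b) (c a).
Proof.
by rewrite op2E; case: (c a) (c b) => [] [] /=; rewrite !mul0r ?add0r ?addr0 // addrC.
Qed.

Lemma braid'Row a b u v x c :
  braid' a b u v x c
  = Rrow u v (fun al be => x (upd (upd c a be) b al)) (c a) (c b).
Proof.
by rewrite op2E; case: (c a) (c b) => [] [] /=; rewrite !mul0r ?add0r ?addr0 // addrC.
Qed.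

Section ThreeSites.
Variables a b s : S.
Hypotheses (ab : a != b) (as_ : a != s) (bs : b != s).
Variable c0 : {ffun S -> bool}.

(** Everything outside the three sites is frozen at [c0], so an update changes one argument and the
    Yang-Baxter equation splits into eight ring identities. *)
Let cfg al be si := upd (upd (upd c0 a al) b be) s si.

Let ba : b != a. Proof. by rewrite eq_sym. Qed.
Let sa : s != a. Proof. by rewrite eq_sym. Qed.
Let sb : s != b. Proof. by rewrite eq_sym. Qed.

Let cfga al be si : cfg al be si a = al.
Proof. by rewrite !(updE, eqxx, negPf as_, negPf ab). Qed.
Let cfgb al be si : cfg al be si b = be.
Proof. by rewrite !(updE, eqxx, negPf bs). Qed.
Let cfgs al be si : cfg al be si s = si.
Proof. by rewrite upd_eq. Qed.
Let upda al be si y : upd (cfg al be si) a y = cfg y be si.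
Proof. by rewrite /cfg (updC _ _ _ as_) (updC _ _ _ ab) upd_upd. Qed.
Let updb al be si y : upd (cfg al be si) b y = cfg al y si.
Proof. by rewrite /cfg (updC _ _ _ bs) upd_upd. Qed.
Let upds al be si y : upd (cfg al be si) s y = cfg al be y.
Proof. by rewrite /cfg upd_upd. Qed.
Let cfgE : cfg (c0 a) (c0 b) (c0 s) = c0.
Proof. by rewrite /cfg !(upd_id c0). Qed.

Let sitesE := (cfga, cfgb, cfgs, upda, updb, upds).

(** Yang-Baxter equation. The common factor [y] does not enter the braid because the R-matrix is
    homogeneous in its two parameters. *)
Lemma braid_RR_at u v y w x :
  braid a b u v (Rop t a s (u * y) w (Rop t b s (v * y) w x)) c0
  = Rop t a s (v * y) w (Rop t b s (u * y) w (braid a b u v x)) c0.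
Proof.
rewrite -cfgE; case: (c0 a) (c0 b) (c0 s) => [] [] [];
  by do ![rewrite !(RopRow, braidRow) !sitesE /= ?sitesE]; ring.
Qed.

(** Yang-Baxter equation for a later line [s] crossing [a] and [b]. The exchanged parameters now
    belong to the crossed spaces, and the braid is built from R_{ba} instead of R_{ab}. *)
Lemma braid'_RR_at u v w x :
  braid' a b u v (Rop t s a (w * u) 1 (Rop t s b (w * v) 1 x)) c0
  = Rop t s a (w * v) 1 (Rop t s b (w * u) 1 (braid' a b u v x)) c0.
Proof.
rewrite -cfgE; case: (c0 a) (c0 b) (c0 s) => [] [] [];
  by do ![rewrite !(RopRow, braid'Row) !sitesE /= ?sitesE]; ring.
Qed.

End ThreeSites.

Lemma braid_RR a b s u v y w x : a != b -> a != s -> b != s ->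
  braid a b u v (Rop t a s (u * y) w (Rop t b s (v * y) w x))
  = Rop t a s (v * y) w (Rop t b s (u * y) w (braid a b u v x)).
Proof. by move=> ab as_ bs; apply/ffunP => c; apply: braid_RR_at. Qed.

Lemma braid'_RR a b s u v w x : a != b -> a != s -> b != s ->
  braid' a b u v (Rop t s a (w * u) 1 (Rop t s b (w * v) 1 x))
  = Rop t s a (w * v) 1 (Rop t s b (w * u) 1 (braid' a b u v x)).
Proof. by move=> ab as_ bs; apply/ffunP => c; apply: braid'_RR_at. Qed.

Section TwoSites.
Variables a b : S.
Hypothesis ab : a != b.
Variable c0 : {ffun S -> bool}.

Let cfg al be := upd (upd c0 a al) b be.

Let ba : b != a. Proof. by rewrite eq_sym. Qed.

Let cfga al be : cfg al be a = al.
Proof. by rewrite !(updE, eqxx, negPf ab). Qed.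
Let cfgb al be : cfg al be b = be.
Proof. by rewrite upd_eq. Qed.
Let upda al be y : upd (cfg al be) a y = cfg y be.
Proof. by rewrite /cfg (updC _ _ _ ab) upd_upd. Qed.
Let updb al be y : upd (cfg al be) b y = cfg al y.
Proof. by rewrite /cfg upd_upd. Qed.
Let cfgE : cfg (c0 a) (c0 b) = c0.
Proof. by rewrite /cfg !(upd_id c0). Qed.

Let sitesE := (cfga, cfgb, upda, updb).

(** Reflection equation. It turns [braid] into [braid'], the form in which the exchange passes
    through the later operators T_k. *)
Lemma braid_KRK_at u v x : u != 0 -> v != 0 ->
  braid a b u v (Kop A B a u (Rop t b a (v * u) 1 (Kop A B b v x))) c0
  = Kop A B a v (Rop t b a (u * v) 1 (Kop A B b u (braid' a b u v x))) c0.
Proof.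
move=> u0 v0; rewrite -cfgE; case: (c0 a) (c0 b) => [] [];
  do ![rewrite !(RopRow, braidRow, braid'Row, KopE) !sitesE /= ?sitesE]; field;
  by rewrite u0 v0.
Qed.

End TwoSites.

Lemma braid_KRK a b u v x : a != b -> u != 0 -> v != 0 ->
  braid a b u v (Kop A B a u (Rop t b a (v * u) 1 (Kop A B b v x)))
  = Kop A B a v (Rop t b a (u * v) 1 (Kop A B b u (braid' a b u v x))).
Proof. by move=> *; apply/ffunP => c; apply: braid_KRK_at. Qed.

(** The row of the R-matrix with outgoing state 00 has a single nonzero entry, so contraction with
    two empty spaces gives a left eigenvector. *)
Lemma braid_row0 a b u v x c : c a = false -> c b = false ->
  braid a b u v x c = (u - t * v) * x c.
Proof.
move=> ca cb; rewrite braidRow ca cb /=.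
by rewrite -{1}ca upd_id -cb upd_id.
Qed.

Lemma braid'_Omega a b u v : a != b ->
  braid' a b u v (Omega F S) = [ffun c => (u - t * v) * Omega F S c].
Proof.
move=> ab; apply/ffunP => c; rewrite op2E !ffunE.
set z := [ffun => false].
have zE r : z r = false by rewrite ffunE.
have h al be : al || be -> (upd (upd c a al) b be == z) = false.
  move=> albe; apply/negP => /eqP/ffunP e; move: (e a) (e b).
  by rewrite !(updE, zE, eqxx) (negPf ab) => ea eb; rewrite ea eb in albe.
rewrite (h true true) // (h true false) // (h false true) // !mulr0 !add0r.
case: (eqVneq c z) => [->|c0].
  have -> : upd (upd z a false) b false = z.
    by apply/ffunP => r; rewrite !updE zE !if_same.
  by rewrite eqxx !zE.
case: eqP => [e|_]; last by rewrite !mulr0.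
(* Here [c] differs from the empty configuration only at [a] and [b], so it holds a particle there;
   the entry leading to it from 00 vanishes by particle conservation. *)
have: c a || c b.
  apply: contraNT c0; rewrite negb_or => /andP[/negPf ca /negPf cb].
  rewrite -e; apply/eqP/ffunP => r; rewrite !updE.
  by case: eqP => [->|_] //; case: eqP => [->|].
by case: (c a) (c b) => [] [] //= _; rewrite ?mul0r ?mulr0.
Qed.

End LocalOperators.

(** * Symmetry in u_1, ..., u_n *)

Lemma op_prod_cat (V : Type) (s1 s2 : seq (V -> V)) x :
  op_prod (s1 ++ s2) x = op_prod s1 (op_prod s2 x).
Proof. by elim: s1 => //= f s1 IH; rewrite IH. Qed.

Section Lines.
Variables (F : fieldType) (t A B : F) (S : finType).
Implicit Types (a b s : S) (u v : F) (x : tensor F S) (p q : S -> F) (l : seq S).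

Definition line a p q l : tensor F S -> tensor F S :=
  op_prod [seq Rop t a s (p s) (q s) | s <- l].

Lemma line_cons a p q s l x :
  line a p q (s :: l) x = Rop t a s (p s) (q s) (line a p q l x).
Proof. by []. Qed.

Lemma line_cat a p q l1 l2 x :
  line a p q (l1 ++ l2) x = line a p q l1 (line a p q l2 x).
Proof. by rewrite /line map_cat op_prod_cat. Qed.

Lemma eq_in_line a p p' q l x :
  {in l, p =1 p'} -> line a p q l x = line a p' q l x.
Proof. by move=> pp; rewrite /line; congr op_prod; apply/eq_in_map => s /pp ->. Qed.

Lemma op2_lineC b s M a p q l x :
  b != a -> s != a -> b \notin l -> s \notin l ->
  op2 b s M (line a p q l x) = line a p q l (op2 b s M x).
Proof.
move=> ba sa; elim: l => //= r l IH.
rewrite !inE !negb_or => /andP[br bl] /andP[sr sl].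
by rewrite !line_cons RopE op2_op2C // IH.
Qed.

Lemma Kop_lineC b u a p q l x :
  b != a -> b \notin l ->
  Kop A B b u (line a p q l x) = line a p q l (Kop A B b u x).
Proof.
move=> ba; elim: l => //= r l IH.
rewrite !inE !negb_or => /andP[br bl].
by rewrite !line_cons RopE Kop_op2C // IH.
Qed.

(** Train argument: at each site the factor of line [b] is commuted in front of the rest of line
    [a]; the two factors are then adjacent and the Yang-Baxter equation applies. *)
Lemma braid_line a b u v y q l x :
  a != b -> uniq l -> a \notin l -> b \notin l ->
  braid t a b u v (line a (fun s => u * y s) q l (line b (fun s => v * y s) q l x))
  = line a (fun s => v * y s) q l (line b (fun s => u * y s) q l (braid t a b u v x)).
Proof.
move=> ab; elim: l => //= s l IH /andP[sl ul].
rewrite !inE !negb_or => /andP[as_ al] /andP[bs bl].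
have ba : b != a by rewrite eq_sym.
have sa : s != a by rewrite eq_sym.
rewrite !line_cons !(RopE _ b) -!(op2_lineC _ _ _ _ ba sa bl sl) -!RopE.
by rewrite braid_RR // IH.
Qed.

Definition scale (k : F) x : tensor F S := [ffun c => k * x c].

Lemma op2_scale a b M k x : op2 a b M (scale k x) = scale k (op2 a b M x).
Proof. by apply/ffunP => c; rewrite /scale op2E [RHS]ffunE op2E !ffunE; ring. Qed.

Lemma Kop_scale a u k x : Kop A B a u (scale k x) = scale k (Kop A B a u x).
Proof. by apply/ffunP => c; rewrite /scale KopE [RHS]ffunE KopE !ffunE; ring. Qed.

Lemma line_scale a p q l k x : line a p q l (scale k x) = scale k (line a p q l x).
Proof. by elim: l => //= s l IH; rewrite !line_cons IH RopE op2_scale. Qed.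

End Lines.

Section Sites.
Variables (F : fieldType) (N n : nat).
Implicit Types (u w : nat -> F) (s : site N n) (i j : 'I_n).

(** With [slope] and [inhom], the factor of T_j at any site [s] is R(u_j * slope s, inhom s), so
    crossings with other lines and with the W_k are treated alike. *)
Definition slope u s : F := match s with inl i => u i.+1 | inr _ => 1 end.
Definition inhom w s : F := match s with inl _ => 1 | inr k => w k.+1 end.

Definition neg_sites (j : nat) : seq (site N n) :=
  [seq inl i | i <- enum 'I_n & (i < j)%N].
Definition pos_sites : seq (site N n) := [seq inr k | k <- rev (enum 'I_N)].

Lemma TopE t A B u w j x :
  Top t A B u w j x
  = line t (inl j : site N n) (fun s => u j.+1 * slope u s) (inhom w)
      (pos_sites ++ neg_sites j) (Kop A B (inl j : site N n) (u j.+1) x).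
Proof.
rewrite /Top catA op_prod_cat /line map_cat -!map_comp; congr (op_prod (_ ++ _) _).
by apply/eq_map => k /=; rewrite mulr1.
Qed.

Lemma Top_scale t A B u w j k x :
  Top t A B u w j (scale k x) = scale k (@Top F t A B N n u w j x).
Proof. by rewrite !TopE Kop_scale line_scale. Qed.

Lemma neg_sitesP (k : nat) i : (inl i \in neg_sites k) = (i < k)%N.
Proof.
rewrite mem_map; last by move=> ? ? [].
by rewrite mem_filter mem_enum andbT.
Qed.

Lemma neg_pos_sites i : inl i \notin pos_sites.
Proof. by apply/mapP => -[]. Qed.

Lemma uniq_line_sites (k : nat) : uniq (pos_sites ++ neg_sites k).
Proof.
have inlI : injective (@inl 'I_n 'I_N) by move=> ? ? [].
have inrI : injective (@inr 'I_n 'I_N) by move=> ? ? [].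
rewrite cat_uniq !map_inj_uniq // rev_uniq (filter_uniq _ (enum_uniq _)) enum_uniq andbT.
by apply/hasPn => _ /mapP[i _ ->]; apply: neg_pos_sites.
Qed.

Lemma enum_split2 (j : nat) (j0 : (j < n)%N) (j1 : (j.+1 < n)%N) :
  exists s1 s2 : seq 'I_n,
    [/\ enum 'I_n = s1 ++ Ordinal j0 :: Ordinal j1 :: s2,
        forall i, i \in s1 -> (i < j)%N & forall i, i \in s2 -> (j.+1 < i)%N].
Proof.
exists (take j (enum 'I_n)), (drop j.+2 (enum 'I_n)); split.
- rewrite -{1}(cat_take_drop j (enum 'I_n)); congr cat.
  rewrite (drop_nth (Ordinal j0)) ?size_enum_ord //.
  rewrite (drop_nth (Ordinal j0)) ?size_enum_ord //.
  by congr [:: _, _ & _]; apply: val_inj; rewrite /= nth_enum_ord.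
- move=> i /(map_f val); rewrite map_take val_enum_ord take_iota mem_iota.
  by move=> /andP[_]; rewrite add0n leq_min => /andP[].
- move=> i /(map_f val); rewrite map_drop val_enum_ord drop_iota mem_iota.
  by move=> /andP[].
Qed.

(** A later line meets the two exchanged spaces consecutively, as [braid'_RR] requires. *)
Lemma neg_sites_split (j : nat) (j0 : (j < n)%N) (j1 : (j.+1 < n)%N) (k : nat) :
  (j.+1 < k)%N ->
  exists l2, neg_sites k = neg_sites j ++ inl (Ordinal j0) :: inl (Ordinal j1) :: l2.
Proof.
move=> jk; have [s1 [s2 [e h1 h2]]] := enum_split2 j0 j1.
exists [seq inl i | i <- s2 & (i < k)%N].
rewrite /neg_sites e !filter_cat /= ltnn (ltnW jk) jk (ltnNge j.+1) leqnSn /=.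
rewrite (@eq_in_filter _ (fun i : 'I_n => (i < j)%N) pred0 s2); last first.
  by move=> i /h2 ji; apply/negbTE; rewrite -leqNgt ltnW // ltnW.
rewrite filter_pred0 cats0 !map_cat /=; congr (map _ _ ++ _).
by apply/eq_in_filter => i /h1 ij; rewrite ij; apply/(ltn_trans ij)/ltnW.
Qed.

(** The extra crossing, with the space of the preceding line, is the R-matrix between the two
    K-matrices in the reflection equation. *)
Lemma neg_sitesS (j : nat) (j0 : (j < n)%N) :
  neg_sites j.+1 = neg_sites j ++ [:: inl (Ordinal j0)].
Proof.
rewrite /neg_sites; have e : enum 'I_n = take j (enum 'I_n) ++ Ordinal j0 :: drop j.+1 (enum 'I_n).
  rewrite -{1}(cat_take_drop j (enum 'I_n)); congr cat.
  rewrite (drop_nth (Ordinal j0)) ?size_enum_ord //.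
  by congr cons; apply: val_inj; rewrite /= nth_enum_ord.
rewrite e !filter_cat /= ltnn leqnn.
rewrite !(@eq_in_filter _ _ pred0 (drop _ _)); first last.
- move=> i /(map_f val); rewrite map_drop val_enum_ord drop_iota mem_iota.
  by rewrite add0n => /andP[ji _]; apply/negbTE; rewrite -leqNgt.
- move=> i /(map_f val); rewrite map_drop val_enum_ord drop_iota mem_iota.
  by rewrite add0n => /andP[ji _]; apply/negbTE; rewrite -leqNgt; apply: ltnW.
rewrite !filter_pred0 !map_cat cats0 /=; congr (map _ _ ++ _).
apply/eq_in_filter => i /(map_f val); rewrite map_take val_enum_ord take_iota mem_iota.
by rewrite add0n leq_min /= => /andP[ij _]; rewrite ltnS ltnW // ij.
Qed.

End Sites.

(** * Exchange of two neighbouring parameters *)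

Section AdjacentSwap.
Variables (F : fieldType) (t A B : F) (N n j : nat) (u u' w : nat -> F).
Hypotheses (j0 : (j < n)%N) (j1 : (j.+1 < n)%N).
Hypotheses (u'j : u' j.+1 = u j.+2) (u'j1 : u' j.+2 = u j.+1).
Hypothesis u'E : forall k, k != j -> k != j.+1 -> u' k.+1 = u k.+1.

Let a : site N n := inl (Ordinal j0).
Let b : site N n := inl (Ordinal j1).
Let X := braid t a b (u j.+1) (u j.+2).
Let Y := braid' t a b (u j.+1) (u j.+2).

Let ab : a != b. Proof. by apply/eqP => -[] /eqP; rewrite eqn_leq ltnn andbF. Qed.
Let ba : b != a. Proof. by rewrite eq_sym. Qed.

Let inl_neq (i : 'I_n) k (k0 : (k < n)%N) :
  i != k :> nat -> (inl (Ordinal k0) : site N n) != inl i.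
Proof. by move=> ik; apply/eqP => -[] e; rewrite -e eqxx in ik. Qed.

Let slopeE s : s != a -> s != b -> slope u' s = slope u s.
Proof.
by case: s => // i ia ib; apply: u'E; [apply: contraNneq ia|apply: contraNneq ib];
  move=> [] e; apply/eqP; congr inl; apply: val_inj.
Qed.

Lemma Top_braid_low (i : 'I_n) x : (i < j)%N ->
  X (Top t A B u w i x) = Top t A B u' w i (X x).
Proof.
move=> ij; have ineq k (k0 : (k < n)%N) : (i < k)%N -> (inl (Ordinal k0) : site N n) != inl i.
  by move=> ik; apply: inl_neq; rewrite ltn_eqF.
have ij1 : (i < j.+1)%N by rewrite ltnW.
have nl k (k0 : (k < n)%N) : (i < k)%N ->
    (inl (Ordinal k0) : site N n) \notin pos_sites N n ++ neg_sites N n i.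
  by move=> ik; rewrite mem_cat (negPf (neg_pos_sites _ _)) neg_sitesP -leqNgt ltnW.
rewrite !TopE /X /braid op2_lineC ?ineq ?nl // -Kop_op2C; first last.
- by rewrite eq_sym ineq.
- by rewrite eq_sym ineq.
have ui : u' i.+1 = u i.+1 by apply: u'E; rewrite ltn_eqF.
rewrite ui; apply: eq_in_line => s sl; rewrite slopeE //.
  by apply: contraTneq sl => ->; apply: nl.
by apply: contraTneq sl => ->; apply: nl.
Qed.

Lemma Top_braid_pair x : u j.+1 != 0 -> u j.+2 != 0 ->
  X (Top t A B u w (Ordinal j0) (Top t A B u w (Ordinal j1) x))
  = Top t A B u' w (Ordinal j0) (Top t A B u' w (Ordinal j1) (Y x)).
Proof.
move=> uj0 uj1; set l := pos_sites N n ++ neg_sites N n j.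
have ul : uniq l by apply: uniq_line_sites.
have nl k (k0 : (k < n)%N) : (j <= k)%N -> (inl (Ordinal k0) : site N n) \notin l.
  by move=> jk; rewrite mem_cat (negPf (neg_pos_sites _ _)) neg_sitesP -leqNgt.
have al : a \notin l by apply: nl.
have bl : b \notin l by apply: nl.
(* The K-matrix of line [a] commutes with line [b] along [l]; this brings together the product K R K
   of the reflection equation. *)
have pairE (v : nat -> F) y :
    Top t A B v w (Ordinal j0) (Top t A B v w (Ordinal j1) y)
    = line t a (fun s => v j.+1 * slope v s) (inhom w) l
        (line t b (fun s => v j.+2 * slope v s) (inhom w) l
          (Kop A B a (v j.+1) (Rop t b a (v j.+2 * v j.+1) 1 (Kop A B b (v j.+2) y)))).
  rewrite !TopE /= neg_sitesS catA -/l (line_cat _ _ _ _ l) -/a -/b.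
  by rewrite Kop_lineC.
rewrite !pairE u'j u'j1.
have sE : {in l, slope u' =1 slope u}.
  by move=> s sl; rewrite slopeE //; apply: contraTneq sl => ->.
rewrite /X braid_line // braid_KRK // -/Y.
rewrite (@eq_in_line _ _ _ _ (fun s => u j.+2 * slope u' s)
  (fun s => u j.+2 * slope u s)); last first.
  by move=> s sl; rewrite sE.
congr line; apply: eq_in_line => s sl.
by rewrite sE.
Qed.

Lemma Top_braid_high (k : 'I_n) x : (j.+1 < k)%N ->
  Y (Top t A B u w k x) = Top t A B u' w k (Y x).
Proof.
move=> jk; have [l2 lE] := neg_sites_split N j0 j1 jk.
have uk : u' k.+1 = u k.+1 by apply: u'E; rewrite gtn_eqF // ltnW.
have ka : a != inl k by apply: inl_neq; rewrite gtn_eqF // ltnW.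
have kb : b != inl k by apply: inl_neq; rewrite gtn_eqF.
have := uniq_line_sites N n k.
rewrite !TopE lE catA -/a -/b; move: (pos_sites N n ++ _) => l1.
rewrite cat_uniq => /and3P[_ /hasPn l1P]; rewrite !cons_uniq inE negb_or -andbA.
move=> /and4P[_ al2 bl2 _].
have al1 : a \notin l1 by apply: l1P; rewrite mem_head.
have bl1 : b \notin l1 by apply: l1P; rewrite !inE eqxx orbT.
have sE : {in l1 ++ l2, slope u' =1 slope u}.
  move=> s sl; rewrite slopeE //; apply: contraTneq sl => ->; rewrite mem_cat negb_or.
    by rewrite al1 al2.
  by rewrite bl1 bl2.
rewrite !line_cat !line_cons /Y /braid' op2_lineC // -/(braid' _ _ _ _ _) /=.
rewrite u'j u'j1 uk.
rewrite (@eq_in_line _ _ _ _ (fun s => u k.+1 * slope u' s)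
  (fun s => u k.+1 * slope u s) _ l1); last first.
  by move=> s sl; rewrite sE // mem_cat sl.
rewrite (@eq_in_line _ _ _ _ (fun s => u k.+1 * slope u' s)
  (fun s => u k.+1 * slope u s) _ l2); last first.
  by move=> s sl; rewrite sE // mem_cat sl orbT.
congr line.
rewrite braid'_RR // ; congr (Rop _ _ _ _ _ (Rop _ _ _ _ _ _)).
by rewrite /braid' op2_lineC // -Kop_op2C // eq_sym.
Qed.

Lemma wavefunction_swap xs : u j.+1 != 0 -> u j.+2 != 0 -> u j.+1 - t * u j.+2 != 0 ->
  wavefunction t A B N n u' w xs = wavefunction t A B N n u w xs.
Proof.
move=> uj0 uj1 uu; have [s1 [s2 [e h1 h2]]] := enum_split2 j0 j1.
apply: (mulfI uu); rewrite /wavefunction /Psi !ffunE.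
set c : {ffun site N n -> bool} := [ffun s => _].
have ca : c a = false by rewrite ffunE.
have cb : c b = false by rewrite ffunE.
rewrite -[RHS](braid_row0 t (u j.+1) (u j.+2) _ ca cb) -/X.
have low l x : (forall i : 'I_n, i \in l -> (i < j)%N) ->
    X (op_prod [seq Top t A B u w i | i <- l] x) = op_prod [seq Top t A B u' w i | i <- l] (X x).
  elim: l => //= i l IH h; rewrite Top_braid_low ?h ?mem_head //; congr Top.
  by apply: IH => r rl; apply: h; rewrite inE rl orbT.
have high l x : (forall i : 'I_n, i \in l -> (j.+1 < i)%N) ->
    Y (op_prod [seq Top t A B u w i | i <- l] x) = op_prod [seq Top t A B u' w i | i <- l] (Y x).
  elim: l => //= i l IH h; rewrite Top_braid_high ?h ?mem_head //; congr Top.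
  by apply: IH => r rl; apply: h; rewrite inE rl orbT.
rewrite e !map_cat !op_prod_cat low //= Top_braid_pair // high //.
rewrite /Y braid'_Omega // -/(scale _ _).
have prod_scale l k x : op_prod [seq Top t A B u' w i | i <- l] (scale k x)
    = scale k (op_prod [seq Top t A B u' w i | i <- l] x).
  by elim: l => //= i l ->; rewrite Top_scale.
by rewrite prod_scale !Top_scale prod_scale [RHS]ffunE.
Qed.

End AdjacentSwap.

(** Insertion sort: [front] moves one entry leftwards by adjacent swaps, and the induction lengthens
    the common prefix [p]. Only rearrangements of [l0] occur, so swaps need to be harmless only
    there. *)
Lemma perm_of_adjacent (T : eqType) (V : Type) (f : seq T -> V) (l0 : seq T) :
  (forall p x y q, perm_eq (p ++ x :: y :: q) l0 ->
     f (p ++ x :: y :: q) = f (p ++ y :: x :: q)) ->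
  forall l, perm_eq l l0 -> f l = f l0.
Proof.
move=> fadj.
have front x p q r : perm_eq (p ++ q ++ x :: r) l0 -> f (p ++ q ++ x :: r) = f (p ++ x :: q ++ r).
  elim/last_ind: q r => // q y IH r; rewrite cat_rcons => h.
  rewrite catA fadj -?catA // IH ?cat_rcons // -(permPr h) !perm_cat2l.
  rewrite -[y :: x :: r]/([:: y; x] ++ r) -[x :: y :: r]/([:: x; y] ++ r) perm_cat2r.
  by rewrite (perm_catC [:: x] [:: y]).
suff h s1 s2 p : perm_eq (p ++ s1) l0 -> perm_eq s1 s2 -> f (p ++ s1) = f (p ++ s2).
  by move=> l ll0; apply: (h l l0 [::]).
elim: s2 s1 p => [|x s2 IH] s1 p hp hs; first by rewrite (perm_nilP hs).
have xs1 : x \in s1 by rewrite (perm_mem hs) mem_head.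
move: hp hs; case/splitPr: xs1 => s3 s4 hp hs.
have hs' : perm_eq (s3 ++ s4) s2.
  by rewrite -(perm_cons x) -(permPr hs) perm_sym (perm_catC _ (x :: _)) /= perm_cons perm_catC.
rewrite front // -!cat_rcons; apply: IH => //.
rewrite -(permPr hp) cat_rcons perm_cat2l perm_sym (perm_catC _ (x :: _)) /= perm_cons perm_catC.
by [].
Qed.

Lemma eq_wavefunction (F : fieldType) (t A B : F) N n (u u' w w' : nat -> F) xs :
  (forall j, (0 < j <= n)%N -> u j = u' j) -> (forall k, (0 < k <= N)%N -> w k = w' k) ->
  wavefunction t A B N n u w xs = wavefunction t A B N n u' w' xs.
Proof.
move=> uu ww; have uE (i : 'I_n) : u i.+1 = u' i.+1 by apply: uu; rewrite /= ltn_ord.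
have wE (k : 'I_N) : w k.+1 = w' k.+1 by apply: ww; rewrite /= ltn_ord.
have TE j x : Top t A B u w j x = @Top F t A B N n u' w' j x.
  rewrite /Top uE; congr (op_prod (_ ++ _ ++ _) _).
    by apply: eq_map => k; rewrite wE.
  by apply: eq_map => k; rewrite uE.
rewrite /wavefunction /Psi; congr (contract0 _ _).
by elim: (enum 'I_n) => //= i l ->; rewrite TE.
Qed.

(** Sorting can bring any two parameters next to each other, hence the nonvanishing condition for
    all pairs of distinct indices. *)
Lemma wavefunction_sym (F : fieldType) (t A B : F) N n (u w : nat -> F) xs (s : nat -> nat) :
  (forall j, (0 < j <= n)%N -> u j != 0) ->
  (forall i j, (0 < i <= n)%N -> (0 < j <= n)%N -> i != j -> u i - t * u j != 0) ->
  perm_eq [seq s j | j <- iota 1 n] (iota 1 n) ->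
  wavefunction t A B N n (fun j => u (s j)) w xs = wavefunction t A B N n u w xs.
Proof.
move=> u0 ut sP.
(* Reorderings are encoded as lists of indices, so that an adjacent swap in the list exchanges two
   neighbouring parameters. *)
pose f (l : seq nat) := wavefunction t A B N n (fun j => u (nth 0%N l j.-1)) w xs.
have fid (r : nat -> nat) :
    wavefunction t A B N n (fun j => u (r j)) w xs = f [seq r j | j <- iota 1 n].
  apply: eq_wavefunction => // -[] // j /= jn.
  by rewrite (nth_map 0%N) ?size_iota // nth_iota // add1n.
rewrite fid (fid id) map_id; apply: (perm_of_adjacent _ sP) => p x y q hp; rewrite /f.
have sz : (size p + (size q).+2)%N = n by rewrite -(size_iota 1 n) -(perm_size hp) size_cat.
have j1 : ((size p).+1 < n)%N by lia.
have mem_n z : z \in p ++ [:: x, y & q] -> (0 < z <= n)%N.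
  by rewrite (perm_mem hp) mem_iota add1n ltnS.
have xn : (0 < x <= n)%N by apply: mem_n; rewrite mem_cat mem_head orbT.
have yn : (0 < y <= n)%N by apply: mem_n; rewrite mem_cat !inE eqxx !orbT.
have xy : x != y.
  have : uniq (p ++ [:: x, y & q]) by rewrite (perm_uniq hp) iota_uniq.
  by rewrite cat_uniq => /and3P[_ _]; rewrite cons_uniq inE negb_or => /andP[/andP[]].
have nth0E a b : nth 0%N (p ++ [:: a, b & q]) (size p) = a by rewrite nth_cat ltnn subnn.
have nth1E a b : nth 0%N (p ++ [:: a, b & q]) (size p).+1 = b.
  by rewrite nth_cat ltnNge leqnSn subSnn.
apply/esym; apply: (@wavefunction_swap _ t A B N n (size p)).
- exact: ltnW.
- by [].
- by rewrite /= nth0E nth1E.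
- by rewrite /= nth0E nth1E.
- move=> k k1 k2; rewrite /= !nth_cat; case: ltngtP k1 k2 => // pk _ k2.
  have: ((size p).+1 < k)%N by rewrite ltn_neqAle eq_sym k2.
  by rewrite -subn_gt0 subnS; case: (k - size p)%N => [|[|m]].
- by rewrite /= nth0E u0.
- by rewrite /= nth1E u0.
- by rewrite /= nth0E nth1E ut.
Qed.

(** * Recursion in N *)

Lemma nat_ind_down (P : nat -> Prop) n :
  P n -> (forall k, (k < n)%N -> P k.+1 -> P k) -> forall k, (k <= n)%N -> P k.
Proof.
move=> Pn IH k kn; rewrite -(subKn kn).
elim: (n - k)%N (leq_subr k n) => [|m Pm] mn; first by rewrite subn0.
by apply: IH; [lia|rewrite subnSK //; apply/Pm/ltnW].
Qed.

Section Stages.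
Variables (F : fieldType) (t A B : F) (N n : nat) (u w : nat -> F).

(** This is T_(k+1) ... T_n applied to |Omega>. As T_n acts first, inductions over stages run
    downwards from [n]. *)
Definition stage (k : nat) : tensor F (site N n) :=
  op_prod [seq Top t A B u w j | j <- drop k (enum 'I_n)] (Omega F (site N n)).

Lemma stage_top : stage n = Omega F (site N n).
Proof. by rewrite /stage drop_oversize // size_enum_ord. Qed.

Lemma stageS k (kn : (k < n)%N) : stage k = Top t A B u w (Ordinal kn) (stage k.+1).
Proof.
rewrite /stage (drop_nth (Ordinal kn)) ?size_enum_ord //=; congr Top.
by apply: val_inj; rewrite /= nth_enum_ord.
Qed.

Definition config0 (f : 'I_N -> bool) : {ffun site N n -> bool} :=
  [ffun s : site N n => match s with inl _ => false | inr k => f k end].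

Lemma wavefunctionE xs :
  wavefunction t A B N n u w xs = stage 0 (config0 (fun k => k.+1 \in xs)).
Proof.
rewrite /wavefunction /Psi ffunE /stage drop0; congr (fun_of_fin _ _).
by apply/ffunP => -[i|k]; rewrite !ffunE.
Qed.

End Stages.

Lemma prod_neg_sites (F : fieldType) N n j (G : site N n -> F) (H : nat -> F) :
  (j <= n)%N -> (forall i : 'I_n, G (inl i) = H i) ->
  \prod_(s <- neg_sites N n j) G s = \prod_(0 <= i < j) H i.
Proof.
move=> jn GH; rewrite big_map big_filter big_enum_cond /=.
rewrite (eq_bigr (fun i : 'I_n => H i)) => [|i _]; last exact: GH.
by rewrite (big_nat_widen _ _ _ _ _ jn) big_mkord.
Qed.

Lemma prod_pos_sites (F : fieldType) N n (G : site N n -> F) (H : nat -> F) :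
  (forall k : 'I_N, G (inr k) = H k) ->
  \prod_(s <- pos_sites N n) G s = \prod_(0 <= k < N) H k.
Proof.
move=> GH; rewrite big_map (perm_big (enum 'I_N)) ?perm_rev //= big_enum /=.
by rewrite big_mkord; apply: eq_bigr.
Qed.

Lemma prod_line_sites (F : fieldType) N n j (G : site N n -> F) (H1 H2 : nat -> F) :
  (j <= n)%N -> (forall k : 'I_N, G (inr k) = H1 k) -> (forall i : 'I_n, G (inl i) = H2 i) ->
  \prod_(s <- pos_sites N n ++ neg_sites N n j) G s
  = \prod_(0 <= k < N) H1 k * \prod_(0 <= i < j) H2 i.
Proof.
move=> jn G1 G2; apply: etrans (big_cat _ _ _ _ _) _.
by rewrite (prod_pos_sites G1) (prod_neg_sites jn G2).
Qed.

(** * Wavefunctions without particles *)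

Section Vacuum.
Variables (F : fieldType) (t A B : F).

(** By particle conservation an empty output forces an empty input at every crossing, so only
    [00|00] contributes. *)
Lemma line_vacuum (S : finType) (a : S) p q l x (c : {ffun S -> bool}) :
  c a = false -> {in l, forall s, c s = false} ->
  line t a p q l x c = \prod_(s <- l) (p s - t * q s) * x c.
Proof.
move=> ca; elim: l => [|s l IH] cl; first by rewrite big_nil mul1r.
have cs : c s = false by rewrite cl ?mem_head.
rewrite line_cons RopRow ca cs /= big_cons.
rewrite -{1}ca upd_id -{1}cs upd_id IH ?mulrA // => r rl.
by apply: cl; rewrite inE rl orbT.
Qed.

(** The K-matrix has no entry from 1 to 0, so particles are never destroyed and the empty final
    state arises only from empty intermediate ones. *)
Lemma wavefunction_vacuum N n (u w : nat -> F) :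
  wavefunction t A B N n u w [::]
  = \prod_(0 <= j < n) ((B * u j.+1 - A) * \prod_(0 <= k < N) (u j.+1 - t * w k.+1)
      * \prod_(0 <= i < j) (u j.+1 * u i.+1 - t)).
Proof.
rewrite wavefunctionE; set c := config0 _ _.
have cE s : c s = false by rewrite ffunE; case: s.
suff h k : (k <= n)%N -> stage t A B N n u w k c
  = \prod_(k <= j < n) ((B * u j.+1 - A) * \prod_(0 <= k < N) (u j.+1 - t * w k.+1)
      * \prod_(0 <= i < j) (u j.+1 * u i.+1 - t)) by apply: h.
apply: (@nat_ind_down (fun k => stage t A B N n u w k c = _)) => {k} [|k kn IH].
  rewrite stage_top ffunE big_geq //; case: eqP => // -[].
  by apply/ffunP => s; rewrite cE ffunE.
rewrite stageS TopE line_vacuum // KopE cE /= mul0r add0r.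
rewrite -{1}(cE (inl (Ordinal kn))) upd_id IH.
rewrite (prod_line_sites (H1 := fun k' => u k.+1 - t * w k'.+1)
  (H2 := fun i => u k.+1 * u i.+1 - t)) ?(ltnW kn) // => [||i]; try by rewrite /= mulr1.
by rewrite [in RHS]big_ltn //; ring.
Qed.

End Vacuum.

(** * The operator that acts first on |Omega> *)

Section OneParticle.
Variables (F : fieldType) (t A B : F) (S : finType) (a : S) (u : F) (p q : S -> F).
Implicit Types (l : seq S) (c : {ffun S -> bool}).

Let y l := line t a p q l (Kop A B a u (Omega F S)).

Lemma line_support l c s : s != a -> s \notin l -> c s -> y l c = 0.
Proof.
move=> sa; elim: l c => [|r l IH] c.
  move=> _ cs; rewrite /y /= KopE !ffunE.
  have z b : (upd c a b == [ffun => false]) = false.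
    by apply/negP => /eqP/ffunP/(_ s); rewrite upd_neq // cs ffunE.
  by rewrite !z !mulr0 addr0.
rewrite inE negb_or => /andP[sr sl] cs.
rewrite /y line_cons RopE op2E -/(y l).
by rewrite !IH ?mulr0 ?addr0 // !upd_neq.
Qed.

(* While the auxiliary line carries the particle, nothing has been deposited:
   a site still to be met is empty, and [10|..] only lets a particle pass an
   empty site. *)
Lemma line_one_particle l c : uniq l -> a \notin l -> c a ->
  y l c = (u - u^-1) * \prod_(s <- l) (p s - q s) * (c == upd [ffun => false] a true)%:R.
Proof.
elim: l => [|s l IH].
  move=> _ _ ca; rewrite big_nil mulr1 /y /= KopE !ffunE ca /=.
  have -> : (upd c a true == [ffun => false]) = false.
    by apply/negP => /eqP/ffunP/(_ a); rewrite upd_eq ffunE.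
  rewrite mulr0 add0r; congr (_ * (nat_of_bool _)%:R); apply/eqP/eqP => [e|->].
    by rewrite -e upd_upd -ca upd_id.
  rewrite upd_upd; apply/ffunP => r; rewrite updE !ffunE; case: eqP => //.
move=> /= /andP[sl ul]; rewrite inE negb_or => /andP[as_ al] ca.
have sa : s != a by rewrite eq_sym.
rewrite /y line_cons RopRow -/(y l) ca; case cs: (c s) => /=.
  rewrite -{1}ca upd_id -{1}cs upd_id (line_support sa sl cs) mulr0.
  case: eqP => [e|]; last by rewrite mulr0.
  by move: cs; rewrite e upd_neq // ffunE.
(* The entry [10|01] would take up a particle from [s], a site that the rest of the line has not
   met. *)
rewrite (@line_support _ _ s) ?upd_eq // mulr0 add0r.
rewrite -{1}ca upd_id -{1}cs upd_id IH // big_cons; ring.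
Qed.

End OneParticle.

(** * Comparison with the lattice lacking the last site *)

Section Embedding.
Variables (F : fieldType) (t A B : F) (N n' n : nat) (nn : (n' <= n)%N).

Definition emb (s : site N n') : site N.+1 n :=
  match s with inl i => inl (widen_ord nn i) | inr k => inr (widen_ord (leqnSn N) k) end.

(* The new site W_(N+1) carries a particle iff b; the new sites W_(-j) are empty. *)
Definition ext (b : bool) (c : {ffun site N n' -> bool}) : {ffun site N.+1 n -> bool} :=
  [ffun s : site N.+1 n => match s with
   | inl i => if insub (val i) is Some i' then c (inl i') else false
   | inr k => if insub (val k) is Some k' then c (inr k') else b
   end].

Lemma extE b c s : ext b c (emb s) = c s.
Proof. by rewrite ffunE; case: s => i /=; rewrite valK. Qed.

Lemma ext_max b c : ext b c (inr ord_max) = b.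
Proof. by rewrite ffunE insubF //= ltnn. Qed.

Lemma upd_ext b c s x : upd (ext b c) (emb s) x = ext b (upd c s x).
Proof.
apply/ffunP => r; rewrite updE.
case: eqP => [->|rs]; first by rewrite extE upd_eq.
rewrite !ffunE; case: r rs => i /= rs; case: insubP => // i' _ e; rewrite updE;
  case: eqP => // e'; case: rs; rewrite -e' /=; congr (_ _); exact: val_inj.
Qed.

Lemma upd_ext_max b c x : upd (ext b c) (inr ord_max) x = ext x c.
Proof.
apply/ffunP => -[i|k]; rewrite updE ?ffunE //.
case: eqP => [[->]|kN]; first by rewrite insubF //= ltnn.
case: insubP => //=; rewrite -leqNgt => h; case: kN.
by congr inr; apply: val_inj; apply/eqP; rewrite eqn_leq h -ltnS ltn_ord.
Qed.

Lemma ext_Omega b c : (ext b c == [ffun => false]) = ~~ b && (c == [ffun => false]).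
Proof.
apply/eqP/andP => [/ffunP e|[/negPf -> /eqP ->]].
  split; first by rewrite -(ext_max b c) e ffunE.
  by apply/eqP/ffunP => s; rewrite -(extE b c) e !ffunE.
by apply/ffunP => -[i|k]; rewrite !ffunE; case: insub => // s; rewrite ffunE.
Qed.

Lemma neg_sites_emb j : (j <= n')%N -> neg_sites N.+1 n j = map emb (neg_sites N n' j).
Proof.
move=> jn; rewrite /neg_sites -map_comp.
rewrite (eq_map (_ : emb \o inl =1 inl \o widen_ord nn)) // [RHS]map_comp.
congr (map _ _).
apply: (inj_map val_inj); rewrite -map_comp (eq_map (_ : val \o widen_ord nn =1 val)) //.
have h m : map val [seq i <- enum 'I_m | (val i < j)%N] = [seq i <- iota 0 m | (i < j)%N].
  by rewrite -val_enum_ord filter_map.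
by rewrite !h !(filter_iota_ltn 0) // (leq_trans jn).
Qed.

Lemma pos_sites_emb : pos_sites N.+1 n = inr ord_max :: map emb (pos_sites N n').
Proof.
rewrite /pos_sites enum_ordSr rev_rcons /= -map_rev -!map_comp.
by congr cons.
Qed.

(* The sites W_(-i) with i > j are empty (inl i is W_(-(i+1))). *)
Definition emptied (j : nat) (c : {ffun site N n' -> bool}) :=
  forall i : 'I_n', (j <= i)%N -> c (inl i) = false.

(** The operators T_1, ..., T_j still to come do not touch W_(-i) for i > j, which are contracted
    with 0 in the end; hence only emptied configurations are compared. *)
Definition sim (b : bool) (j : nat) (k : F) (x : tensor F (site N.+1 n))
    (x' : tensor F (site N n')) :=
  forall c, emptied j c -> x (ext b c) = k * x' c.

Definition below (j : nat) (s : site N n') :=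
  match s with inl i => (i < j)%N | inr _ => true end.

Lemma emptied_upd j c s y : below j s -> emptied j c -> emptied j (upd c s y).
Proof.
move=> sj cj i ji; rewrite upd_neq ?cj //.
by apply: contraTneq sj => <-; rewrite /= -leqNgt.
Qed.

Lemma emptiedS j c : emptied j c -> emptied j.+1 c.
Proof. by move=> cj i ji; apply/cj/ltnW. Qed.

Lemma sim_Rop b j k x x' s1 s2 u w : below j s1 -> below j s2 -> sim b j k x x' ->
  sim b j k (Rop t (emb s1) (emb s2) u w x) (Rop t s1 s2 u w x').
Proof.
move=> j1 j2 xx' c cj.
rewrite !RopE !op2E !extE !upd_ext !xx'; try by do 2 apply: emptied_upd => //.
by ring.
Qed.

Lemma sim_Kop b j k x x' s u : below j s -> sim b j k x x' ->
  sim b j k (Kop A B (emb s) u x) (Kop A B s u x').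
Proof.
move=> js xx' c cj.
rewrite !KopE !extE !upd_ext !xx'; try by apply: emptied_upd.
by ring.
Qed.

Lemma sim_line b j k x x' a p q l : below j a -> all (below j) l -> sim b j k x x' ->
  sim b j k (line t (emb a) p q (map emb l) x) (line t a (p \o emb) (q \o emb) l x').
Proof.
move=> ja; elim: l => //= s l IH /andP[js jl] xx'.
by rewrite !line_cons; apply: sim_Rop => //; apply: IH.
Qed.

(** The crossing with the last site is left out. Until it is made, the space of the line itself may
    be in either state, hence [j.+1] on both sides. *)
Lemma sim_Top_inner b (j : 'I_n') k x x' (u w : nat -> F) : sim b j.+1 k x x' ->
  sim b j.+1 k
    (line t (emb (inl j)) (fun s => u j.+1 * slope u s) (inhom w)
      (map emb (pos_sites N n' ++ neg_sites N n' j)) (Kop A B (emb (inl j)) (u j.+1) x))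
    (Top t A B u w j x').
Proof.
move=> xx'; rewrite TopE.
have ps : (fun s => u j.+1 * slope u s) =1 (fun s => u j.+1 * slope u s) \o emb by case.
have qs : inhom w =1 inhom w \o emb by case.
rewrite (_ : line t (inl j : site N n') _ _ _ _ = line t (inl j)
  ((fun s => u j.+1 * slope u s) \o emb) (inhom w \o emb) (pos_sites N n' ++ neg_sites N n' j)
  (Kop A B (inl j) (u j.+1) x')); last first.
  by rewrite /line; congr (op_prod _ _); apply: eq_map => s; rewrite ps qs.
apply: sim_line; [exact: ltnSn| |by apply: sim_Kop => //; apply: ltnSn].
by apply/allP => -[i|//]; rewrite mem_cat (negPf (neg_pos_sites _ _)) neg_sitesP /= => /ltnW.
Qed.

Lemma Top_embE (j : 'I_n') x (u w : nat -> F) :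
  Top t A B u w (widen_ord nn j) x
  = Rop t (emb (inl j)) (inr ord_max) (u j.+1) (w N.+1)
     (line t (emb (inl j)) (fun s => u j.+1 * slope u s) (inhom w)
      (map emb (pos_sites N n' ++ neg_sites N n' j)) (Kop A B (emb (inl j)) (u j.+1) x)).
Proof.
rewrite TopE pos_sites_emb neg_sites_emb ?map_cat ?(ltnW (ltn_ord j)) //.
by rewrite cat_cons line_cons /= mulr1.
Qed.

Lemma sim_Top_empty (j : 'I_n') k x x' (u w : nat -> F) : sim false j.+1 k x x' ->
  sim false j ((u j.+1 - t * w N.+1) * k) (Top t A B u w (widen_ord nn j) x) (Top t A B u w j x').
Proof.
move=> /(@sim_Top_inner _ _ _ _ _ u w) xx' c cj; rewrite Top_embE RopRow ext_max extE cj //=.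
have e: upd (ext false c) (emb (inl j)) false = ext false c.
  by apply: upd_same; rewrite extE cj.
by rewrite -/(emb (inl j)) e upd_ext_max xx' ?mulrA //; apply: emptiedS.
Qed.

(** A full last site was full before, with weight [01|01], or is filled by this line; the second
    term vanishes because [x] has no relevant component with an empty last site. *)
Lemma sim_Top_full (j : 'I_n') k x x' x'' (u w : nat -> F) :
  sim true j.+1 k x x' -> sim false j.+1 0 x x'' ->
  sim true j (t * (u j.+1 - w N.+1) * k) (Top t A B u w (widen_ord nn j) x) (Top t A B u w j x').
Proof.
move=> /(@sim_Top_inner _ _ _ _ _ u w) xx' /(@sim_Top_inner _ _ _ _ _ u w) x0 c cj.
rewrite Top_embE RopRow ext_max extE cj //=.
have e: upd (ext true c) (emb (inl j)) false = ext true c.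
  by apply: upd_same; rewrite extE cj.
rewrite -/(emb (inl j)) e !upd_ext !upd_ext_max xx' ?x0 ?mul0r ?mulr0 ?addr0 ?mulrA //;
  last exact: emptiedS.
by apply: emptied_upd => /=; [apply: ltnSn|apply: emptiedS].
Qed.

End Embedding.

Section Recursion.
Variables (F : fieldType) (t A B : F) (N n : nat) (u w : nat -> F).

Lemma ext_config0 n' (nn : (n <= n')%N) (b : bool) (xs ys : seq nat) :
  (forall k, (k < N)%N -> (k.+1 \in xs) = (k.+1 \in ys)) -> (N.+1 \in xs) = b ->
  config0 n' (fun k : 'I_N.+1 => k.+1 \in xs)
  = ext n' b (config0 n (fun k : 'I_N => k.+1 \in ys)).
Proof.
move=> xy xb; apply/ffunP => -[i|k]; rewrite !ffunE.
  by case: insub => // i'; rewrite ffunE.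
case: insubP => [k' _ e|]; first by rewrite ffunE -e xy ?ltn_ord.
rewrite -leqNgt => Nk; have -> : k = N :> nat by apply/eqP; rewrite eqn_leq Nk -ltnS ltn_ord.
by [].
Qed.

Lemma wavefunction_last_empty xs : N.+1 \notin xs ->
  wavefunction t A B N.+1 n u w xs
  = \prod_(0 <= i < n) (u i.+1 - t * w N.+1) * wavefunction t A B N n u w xs.
Proof.
move=> Nxs; have h k : (k <= n)%N ->
    sim (n' := n) (n := n) false k (\prod_(k <= i < n) (u i.+1 - t * w N.+1))
      (stage t A B N.+1 n u w k) (stage t A B N n u w k).
  apply: (@nat_ind_down (fun k => sim false k _ _ _)) => {k} [c _|k kn IH].
    by rewrite big_geq // mul1r !stage_top !ffunE ext_Omega.
  rewrite big_ltn // !(stageS _ _ _ _ _ _ kn).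
  rewrite {1}(_ : Ordinal kn = widen_ord (leqnn n) (Ordinal kn)); last exact: val_inj.
  exact: (@sim_Top_empty F t A B N n n (leqnn n) (Ordinal kn) _ _ _ u w IH).
rewrite !wavefunctionE -(h 0%N) // => [|i _]; last by rewrite ffunE.
by congr (fun_of_fin _ _); apply: ext_config0 => //; apply: negbTE.
Qed.

Lemma wavefunction_last_full xs : u n.+1 != 0 -> t * w N.+1 = u n.+1 ->
  wavefunction t A B N.+1 n.+1 u w (rcons xs N.+1)
  = (1 - t) * \prod_(0 <= i < n) (t * u i.+1 - u n.+1)
    * \prod_(0 <= i < n.+1) (u i.+1 * u n.+1 - 1)
    * \prod_(0 <= k < N) (u n.+1 - w k.+1) * wavefunction t A B N n u w xs.
Proof.
move=> un0 wN; pose nn := leqnSn n.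
pose a : site N.+1 n.+1 := inl ord_max.
pose z : site N.+1 n.+1 := inr ord_max.
(* Amplitude for T_(n+1) to create a particle in its K-matrix, carry it past all other sites and
   deposit it at the last one. *)
pose kappa := (1 - t) * (u n.+1 * (u n.+1 - (u n.+1)^-1)
  * (\prod_(0 <= k < N) (u n.+1 - w k.+1) * \prod_(0 <= i < n) (u i.+1 * u n.+1 - 1))).
pose l := map (emb nn) (pos_sites N n) ++ neg_sites N.+1 n.+1 n.
have lE : pos_sites N.+1 n.+1 ++ neg_sites N.+1 n.+1 n = z :: l by rewrite (pos_sites_emb _ nn).
have /= /andP[zl ul] : uniq (z :: l) by rewrite -lE uniq_line_sites.
have al : a \notin z :: l.
  by rewrite -lE mem_cat (negPf (neg_pos_sites _ _)) neg_sitesP ltnn.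
move: al; rewrite inE negb_or => /andP[_ al].
have za : z != a by [].
have exta b (c : {ffun site N n -> bool}) : ext n.+1 b c a = false.
  by rewrite ffunE /= insubF //= ltnn.
have stagen c : stage t A B N.+1 n.+1 u w n c
    = Rop t a z (u n.+1) (w N.+1)
       (line t a (fun s => u n.+1 * slope u s) (inhom w) l (Kop A B a (u n.+1) (Omega F _))) c.
  rewrite stageS stage_top (_ : Ordinal _ = ord_max); last exact: val_inj.
  by rewrite TopE lE line_cons /= mulr1.
have prodl : \prod_(s <- l) (u n.+1 * slope u s - inhom w s)
    = \prod_(0 <= k < N) (u n.+1 - w k.+1) * \prod_(0 <= i < n) (u i.+1 * u n.+1 - 1).
  rewrite big_cat big_map /=; congr (_ * _).
    by rewrite (prod_pos_sites (H := fun k => u n.+1 - w k.+1)) // => k /=; rewrite mulr1.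
  by apply: prod_neg_sites => // i /=; rewrite mulrC.
(* The second half, vanishing of the components with empty last site, is what [sim_Top_full] needs
   at the next stage. *)
have h k : (k <= n)%N ->
    sim true k (kappa * \prod_(k <= i < n) (t * u i.+1 - u n.+1))
      (stage t A B N.+1 n.+1 u w k) (stage t A B N n u w k)
    /\ sim false k 0 (stage t A B N.+1 n.+1 u w k) (stage t A B N n u w k).
  apply: (@nat_ind_down (fun k => sim true k _ _ _ /\ sim false k _ _ _)) => {k} [|k kn [IH1 IH0]].
    (* An empty last site has weight [u n.+1 - t * w N.+1], which is 0. For a full one the term
       [01|01] drops out, since the rest of the line never meets [z]. *)
    split=> c _; rewrite stagen RopRow exta ext_max /=; last by rewrite wN subrr !mul0r.
    have e0 : upd (upd (ext n.+1 true c) a false) z true = ext n.+1 true c.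
      by rewrite !upd_same // ext_max.
    have e1 : upd (upd (ext n.+1 true c) a true) z false = upd (ext n.+1 false c) a true.
      by rewrite (updC _ _ _ za) upd_ext_max.
    rewrite e0 e1 (line_support _ _ _ _ _ _ za zl) ?ext_max // mulr0 add0r.
    rewrite line_one_particle ?upd_eq //.
    have eC : (upd (ext n.+1 false c) a true == upd [ffun => false] a true)
        = (c == [ffun => false]).
      have := ext_Omega nn false c; rewrite /= => <-; apply/eqP/eqP => [e|-> //].
      rewrite -[LHS](upd_same (exta false c)) -(upd_upd _ _ true) e upd_upd upd_same //.
      by rewrite ffunE.
    rewrite eC prodl [in RHS](@big_geq _ _ _ n) //
      stage_top ffunE /kappa; ring.
  have -> : stage t A B N.+1 n.+1 u w k
      = Top t A B u w (widen_ord nn (Ordinal kn)) (stage t A B N.+1 n.+1 u w k.+1).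
    by rewrite (stageS _ _ _ _ _ _ (ltnW kn : (k < n.+1)%N)); congr Top; apply: val_inj.
  rewrite (stageS _ _ _ _ _ _ kn) big_ltn //; split.
    have := @sim_Top_full F t A B N n n.+1 nn (Ordinal kn) _ _ _ _ u w IH1 IH0.
    move=> + c ck => /(_ c ck) ->; congr (_ * _).
    by rewrite -wN; ring.
  have := @sim_Top_empty F t A B N n n.+1 nn (Ordinal kn) _ _ _ u w IH0.
  by move=> + c ck => /(_ c ck) ->; rewrite mulr0 !mul0r.
have [h1 _] := h 0%N (leq0n n).
rewrite !wavefunctionE (@ext_config0 n.+1 nn true _ xs); first last.
- by rewrite mem_rcons mem_head.
- by move=> k kN; rewrite mem_rcons inE eqSS ltn_eqF.
rewrite h1 => [|i _]; last by rewrite ffunE.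
congr (_ * _); rewrite /kappa big_nat_recr //= -[u n.+1 * _]/(u n.+1 * _).
(* The weight of the K-matrix times part of the deposit weight is the last factor of the product
   over [u i.+1 * u n.+1 - 1]. *)
have -> : u n.+1 * (u n.+1 - (u n.+1)^-1) = u n.+1 * u n.+1 - 1.
  by rewrite mulrBr mulfV.
by ring.
Qed.

End Recursion.

(** * Specialization of w_N *)

Section Parametricity.
Variables (F F' : fieldType) (rel : F -> F' -> Prop).
Hypotheses (rel0 : rel 0 0) (rel1 : rel 1 1).
Hypothesis relD : forall x x' y y', rel x x' -> rel y y' -> rel (x + y) (x' + y').
Hypothesis relM : forall x x' y y', rel x x' -> rel y y' -> rel (x * y) (x' * y').
Hypothesis relN : forall x x', rel x x' -> rel (- x) (- x').

Let relB x x' y y' : rel x x' -> rel y y' -> rel (x - y) (x' - y').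
Proof. by move=> hx hy; apply: relD => //; apply: relN. Qed.

(** Substitution into rational functions is only partially defined, so it is a relation and not a
    ring morphism. The wavefunction is built by ring operations from its parameters and the inverses
    of the u_j, so it respects every such relation. *)
Lemma wavefunction_rel N n t t' A A' B B' (u w : nat -> F) (u' w' : nat -> F') xs :
  rel t t' -> rel A A' -> rel B B' ->
  (forall j, (0 < j <= n)%N -> rel (u j) (u' j) /\ rel (u j)^-1 (u' j)^-1) ->
  (forall k, (0 < k <= N)%N -> rel (w k) (w' k)) ->
  rel (wavefunction t A B N n u w xs) (wavefunction t' A' B' N n u' w' xs).
Proof.
move=> ht hA hB hu hw; rewrite !wavefunctionE /stage !drop0.
pose tr (x : tensor F (site N n)) (x' : tensor F' (site N n)) := forall c, rel (x c) (x' c).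
have trR a b y y' z z' x x' : rel y y' -> rel z z' -> tr x x' ->
    tr (Rop t a b y z x) (Rop t' a b y' z' x').
  move=> hy hz hx c; rewrite !RopE !op2E.
  by case: (c a) (c b) => [] [] /=; do !apply: relD; apply: relM => //;
    do ?apply: relM => //; do ?apply: relB => //; apply: relM.
have trK a y y' x x' : rel y y' -> rel y^-1 y'^-1 -> tr x x' ->
    tr (Kop A B a y x) (Kop A' B' a y' x').
  move=> hy hyV hx c; rewrite !KopE.
  by case: (c a) => /=; apply: relD; apply: relM => //; do ?apply: relB => //; apply: relM.
have trline a p q p' q' l x x' : (forall s, s \in l -> rel (p s) (p' s) /\ rel (q s) (q' s)) ->
    tr x x' -> tr (line t a p q l x) (line t' a p' q' l x').
  move=> + hx; elim: l => // s l IH h; rewrite !line_cons.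
  have [hp hq] := h s (mem_head _ _); apply: trR => //.
  by apply: IH => r rl; apply: h; rewrite inE rl orbT.
have hu' (i : 'I_n) : rel (u i.+1) (u' i.+1) /\ rel (u i.+1)^-1 (u' i.+1)^-1.
  by apply: hu; rewrite /= ltn_ord.
suff h l x x' : tr x x' -> tr (op_prod [seq Top t A B u w i | i <- l] x)
    (op_prod [seq Top t' A' B' u' w' i | i <- l] x').
  by apply: h => c; rewrite !ffunE; case: eqP.
move=> hx; elim: l => // i l IH; rewrite /= !TopE; have [ui uiV] := hu' i.
apply: trline; last exact: trK.
case=> [r|k] _ /=; split=> //; first by apply: relM => //; case: (hu' r).
  exact: relM.
by apply: hw; rewrite /= ltn_ord.
Qed.

End Parametricity.

Section Substitution.
Variables (R : realType) (l : nat).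
Implicit Types (f g v : ratfun R l) (a b : {mpoly R[i][l]}) (k : 'I_l).

(** Makes [mpoly_subst], an [mmap] along [constC], a ring morphism. *)
HB.instance Definition _ :=
  GRing.RMorphism.copy (@constC R l) (@tofrac {mpoly R[i][l]} \o @mpolyC l R[i]).

Section Eval.
Variables (k : 'I_l) (c : ratfun R l).

Let subD a b : mpoly_subst k c (a + b) = mpoly_subst k c a + mpoly_subst k c b.
Proof. exact: rmorphD. Qed.
Let subN a : mpoly_subst k c (- a) = - mpoly_subst k c a. Proof. exact: rmorphN. Qed.
Let subM a b : mpoly_subst k c (a * b) = mpoly_subst k c a * mpoly_subst k c b.
Proof. exact: rmorphM. Qed.
Let sub0 : mpoly_subst k c 0 = 0. Proof. exact: rmorph0. Qed.
Let sub1 : mpoly_subst k c 1 = 1. Proof. exact: rmorph1. Qed.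

Let den_neq0 b : mpoly_subst k c b != 0 -> tofrac b != 0 :> ratfun R l.
Proof. by rewrite tofrac_eq0; apply: contraNneq => ->; rewrite sub0. Qed.

Lemma subst_tofrac a : subst_eq (tofrac a) k c (mpoly_subst k c a).
Proof. by exists a, 1; rewrite sub1 oner_eq0 tofrac1 !divr1. Qed.

Lemma subst_var i : subst_eq (var R i) k c (if i == k then c else var R i).
Proof. by have := subst_tofrac 'X_i; rewrite /mpoly_subst mmapX mmap1U. Qed.

Lemma subst0 : subst_eq 0 k c 0.
Proof. by have := subst_tofrac 0; rewrite sub0 tofrac0. Qed.

Lemma subst1 : subst_eq 1 k c 1.
Proof. by have := subst_tofrac 1; rewrite sub1 tofrac1. Qed.

Lemma substD f g v v' : subst_eq f k c v -> subst_eq g k c v' -> subst_eq (f + g) k c (v + v').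
Proof.
move=> [a [b [b0 -> ->]]] [a' [b' [b'0 -> ->]]].
have d := den_neq0 b0; have d' := den_neq0 b'0.
exists (a * b' + a' * b), (b * b'); split.
- by rewrite (subM b); exact: (mulf_neq0 b0 b'0).
- rewrite (tofracD (a * b')) (tofracM a) (tofracM a') (tofracM b).
  exact: (addf_div _ _ d d').
- rewrite (subD (a * b')) (subM a) (subM a') (subM b); exact: (addf_div _ _ b0 b'0).
Qed.

Lemma substM f g v v' : subst_eq f k c v -> subst_eq g k c v' -> subst_eq (f * g) k c (v * v').
Proof.
move=> [a [b [b0 -> ->]]] [a' [b' [b'0 -> ->]]].
exists (a * a'), (b * b'); split.
- by rewrite (subM b); exact: (mulf_neq0 b0 b'0).
- rewrite (tofracM a) (tofracM b); exact: mulf_div.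
- rewrite (subM a) (subM b); exact: mulf_div.
Qed.

Lemma substN f v : subst_eq f k c v -> subst_eq (- f) k c (- v).
Proof.
move=> [a [b [b0 -> ->]]]; exists (- a), b; rewrite (subN a) (tofracN a).
by split; [exact: b0|exact: (esym (mulNr _ _))|exact: (esym (mulNr _ _))].
Qed.

(** Numerator and denominator trade places; [v != 0] keeps the new denominator from vanishing under
    the substitution. *)
Lemma substV f v : v != 0 -> subst_eq f k c v -> subst_eq f^-1 k c v^-1.
Proof.
move=> v0 [a [b [b0 -> e]]]; exists b, a; split.
- by apply: contraNneq v0 => a0; rewrite e a0 mul0r.
- exact: invf_div.
- by rewrite e; exact: invf_div.
Qed.

End Eval.
End Substitution.

(** * Degree in w_N *)

(* To see that the leading coefficient in w_N does not vanish, all weights are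
   taken at a point where they are nonnegative: [pos false] and [pos true]
   stand for elements of nonnegative and of positive value there, and
   [free] for elements not depending on the indeterminate z = w_N. *)
Section Degree.
Variables (F : fieldType) (free : F -> Prop) (pos : bool -> F -> Prop).
Hypotheses (free0 : free 0).
Hypothesis freeD : forall f g, free f -> free g -> free (f + g).
Hypothesis freeN : forall f, free f -> free (- f).
Hypothesis freeM : forall f g, free f -> free g -> free (f * g).
Hypotheses (pos0 : pos false 0) (pos1 : pos true 1).
Hypothesis pos_free : forall s f, pos s f -> free f.
Hypothesis pos_neq0 : forall f, pos true f -> f != 0.
Hypothesis posW : forall s f, pos s f -> pos false f.
Hypothesis posD : forall s1 s2 f g, pos s1 f -> pos s2 g -> pos (s1 || s2) (f + g).
Hypothesis posM : forall s1 s2 f g, pos s1 f -> pos s2 g -> pos (s1 && s2) (f * g).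

Variable z : F.

(* A polynomial in z of formal degree e - 1 and leading sign (-1)^(e-1); it is
   0 when e = 0. *)
Definition alt_poly (e : nat) (s : bool) (f : F) := exists p : {poly F},
  [/\ forall i, free p`_i, (size p <= e)%N, pos s ((-1) ^+ e.+1 * p`_e.-1) & f = p.[z]].

Lemma alt_poly0 e : alt_poly e false 0.
Proof.
by exists 0; rewrite size_poly0 horner0 coef0 mulr0; split => // i; rewrite coef0.
Qed.

Lemma alt_poly1 : alt_poly 1 true 1.
Proof.
exists 1; rewrite size_poly1 hornerC coef1 /= sqrrN expr1n mulr1; split => // i.
by rewrite coef1; case: eqP => _ //=; apply: pos_free pos1.
Qed.

Lemma alt_polyW e s f : alt_poly e s f -> alt_poly e false f.
Proof. by move=> [p [h1 h2 h3 h4]]; exists p; split => //; apply: posW h3. Qed.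

Lemma alt_polyD e s1 s2 f g :
  alt_poly e s1 f -> alt_poly e s2 g -> alt_poly e (s1 || s2) (f + g).
Proof.
move=> [p [h1 h2 h3 ->]] [q [k1 k2 k3 ->]]; exists (p + q); split.
- by move=> i; rewrite coefD; apply: freeD.
- by rewrite (leq_trans (size_polyD _ _)) // geq_max h2.
- by rewrite coefD mulrDr; apply: posD.
- by rewrite hornerD.
Qed.

Lemma alt_polyZ e s1 s2 k f :
  pos s1 k -> alt_poly e s2 f -> alt_poly e (s1 && s2) (k * f).
Proof.
move=> hk [p [h1 h2 h3 ->]]; exists (k%:P * p); split.
- by move=> i; rewrite coefCM; apply: freeM => //; apply: pos_free hk.
- by rewrite mul_polyC (leq_trans (size_scale_leq _ _)).
- by rewrite coefCM mulrCA; apply: posM.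
- by rewrite hornerM hornerC.
Qed.

(** The top coefficient is multiplied by [- c2], which matches the sign change from one formal
    degree to the next. *)
Lemma alt_poly_lin e s c1 c2 f : free c1 -> pos true c2 ->
  alt_poly e s f -> alt_poly e.+1 s ((c1 - c2 * z) * f).
Proof.
move=> h1 h2 [p [p1 p2 p3 ->]]; exists (c1%:P * p - c2%:P * (p * 'X)).
have cE i : (c1%:P * p - c2%:P * (p * 'X))`_i = c1 * p`_i - c2 * (if i is j.+1 then p`_j else 0).
  by rewrite coefB !coefCM coefMX; case: i.
split.
- move=> i; rewrite cE; apply: freeD; first exact: freeM.
  by apply/freeN/freeM; [apply: pos_free h2|case: i].
- apply/leq_sizeP => i ei; rewrite cE; case: i ei => // i ei.
  have pz j : (e <= j)%N -> p`_j = 0 by move=> ej; apply: (leq_sizeP _ _ p2).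
  by rewrite !pz ?mulr0 ?subrr // ltnW.
- rewrite cE /=; have -> : p`_e = 0 by apply: (leq_sizeP _ _ p2).
  (* For [e] = 0 the index [e.-1] is 0 as well, but then [p] is 0. *)
  have -> : (if e is j.+1 then p`_j else 0) = p`_e.-1.
    by case: (e) p2 => //; rewrite leqn0 size_poly_eq0 => /eqP ->; rewrite coef0.
  have -> : (-1) ^+ e.+2 * (c1 * 0 - c2 * p`_e.-1) = c2 * ((-1) ^+ e.+1 * p`_e.-1).
    by rewrite (exprS _ e.+1) mulr0 sub0r mulN1r mulrNN mulrCA.
  by apply: (posM (s1 := true)).
- by rewrite hornerD hornerN !hornerM !hornerC hornerX; ring.
Qed.

Section Local.
Variables (S : finType) (P : {ffun S -> bool} -> Prop) (e : {ffun S -> bool} -> nat).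
Implicit Types (x : tensor F S) (T : {ffun S -> bool}).

(** One configuration [T] is tracked through the operators: every component has the expected weak
    sign, and the component at [T] the strict one. *)
Definition leading T x := forall c, P c -> alt_poly (e c) (c == T) (x c).

Definition local_at (a : S) :=
  (forall c y, P c -> P (upd c a y)) /\ (forall c y, e (upd c a y) = e c).

(** Contributions of equal sign cannot cancel, so a single transition of positive weight from [T] to
    [T'] suffices. *)
Lemma leading_op2 a b M T T' x (al be : bool) : local_at a -> local_at b ->
  (forall c ga de, P c -> pos false (M (c a) (c b) ga de)) ->
  pos true (M (T' a) (T' b) al be) -> upd (upd T' a al) b be = T ->
  leading T x -> leading T' (op2 a b M x).
Proof.
move=> [Pa ea] [Pb eb] hM hT TT' hx c Pc.
have hc y y' : alt_poly (e c) (upd (upd c a y) b y' == T) (x (upd (upd c a y) b y')).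
  by have := hx (upd (upd c a y) b y'); rewrite eb ea; apply; apply/Pb/Pa.
have w y y' : alt_poly (e c) false (M (c a) (c b) y y' * x (upd (upd c a y) b y')).
  by apply: (alt_polyZ (s1 := false) _ (hc y y')); apply: hM.
(* The table [s] records which of the four terms is known to be strict: the one for ([al], [be]) if
   [c] is [T'], and none otherwise. *)
have [h] : exists s : bool -> bool -> bool, (forall y y',
    alt_poly (e c) (s y y') (M (c a) (c b) y y' * x (upd (upd c a y) b y')))
    /\ (c == T') = s true true || s true false || (s false true || s false false).
  case: (eqVneq c T') => [cT|_]; last by exists (fun _ _ => false).
  exists (fun y y' => (y == al) && (y' == be)); split; last by case: (al) (be) => [] [].
  move=> y y'; case: (y =P al) => [->|_] //; case: (y' =P be) => [->|_] //=.
  apply: (alt_polyZ (s1 := true) (s2 := true)); first by rewrite cT.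
  by have := hc al be; rewrite {2}cT TT' eqxx.
by move=> [hs ->]; rewrite op2E; do !apply: alt_polyD.
Qed.

End Local.

Variables (t A B : F).
Hypotheses (tpos : pos true t) (t1pos : pos true (1 - t)).

Definition good (u w : F) := [/\ pos true u, pos true w, pos true (u - w) & pos true (u - t * w)].

(** The entries obeying particle conservation are the six nonzero ones, each a product of quantities
    assumed positive. *)
Lemma Rentry_pos_true u w (ga de al be : bool) : good u w -> (ga + de = al + be)%N ->
  pos true (Rentry t u w ga de al be).
Proof.
move=> [hu hw huw hutw].
by case: ga de al be => [] [] [] [] //= _; apply: (posM (s1 := true) (s2 := true)).
Qed.

Lemma Rentry_pos u w ga de al be : good u w -> pos false (Rentry t u w ga de al be).
Proof.
move=> huw; case: (altP (ga + de =P al + be)%N) => [e|].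
  by apply: (@posW true); apply: Rentry_pos_true.
by case: ga de al be => [] [] [] [].
Qed.

(** * Sign and degree along the tracked configurations *)

Section Boundary.
Variables (N n : nat) (u w : nat -> F) (xs : seq nat).
Hypothesis wz : w N.+1 = z.
Hypothesis (u_pos : forall j, (0 < j <= n)%N -> pos true (u j)).
Hypothesis uK : forall j, (0 < j <= n)%N ->
  [/\ pos true (B * u j - A), pos true (u j - (u j)^-1) & pos true (B / u j - A)].
Hypothesis uw : forall j k, (0 < j <= n)%N -> (0 < k <= N)%N -> good (u j) (w k).
Hypothesis uu : forall i j, (0 < i <= n)%N -> (0 < j <= n)%N -> good (u i * u j) 1.
Hypotheses (xs_sorted : sorted ltn xs) (xs_range : all (fun k => (1 <= k <= N.+1)%N) xs).
Hypothesis xs_size : (size xs <= n)%N.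

Let S := site N.+1 n.
Let a_ (j : 'I_n) : S := inl j.
Let zs : S := inr ord_max.

(** The tracked configuration after T_(j+1), ..., T_n: the line of T_i deposits its particle at x_i,
    so x_(j+1), ..., x_m are in place. *)
Definition occ (j : nat) : {ffun S -> bool} :=
  config0 n (fun k : 'I_N.+1 => k.+1 \in drop j xs).

(** [d] lines have crossed the last site, each with a factor linear in [z] except the one filling
    it; the value is that degree plus one, the size bound of [alt_poly]. *)
Let deg d (c : {ffun S -> bool}) : nat := (d + ~~ c zs)%N.

Definition leading_at (k d : nat) (T : {ffun S -> bool}) (x : tensor F S) :=
  leading (@emptied N.+1 n k) (deg d) T x.

Lemma local_below k d s : below k s -> s != zs -> local_at (@emptied N.+1 n k) (deg d) s.
Proof.
move=> sk sz; split=> [c y Pc|c y]; first exact: emptied_upd.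
by rewrite /deg upd_neq // eq_sym.
Qed.

Lemma occ_inl j i : occ j (inl i) = false. Proof. by rewrite ffunE. Qed.

Lemma occ_inr j k : occ j (inr k) = (k.+1 \in drop j xs). Proof. by rewrite ffunE. Qed.

Lemma uE (j : 'I_n) : (0 < j.+1 <= n)%N. Proof. exact: ltn_ord. Qed.

Lemma leading_Kop (j : 'I_n) d x : leading_at j.+1 d (occ j.+1) x ->
  leading_at j.+1 d (upd (occ j.+1) (a_ j) (j < size xs)%N) (Kop A B (a_ j) (u j.+1) x).
Proof.
have [K1 K2 K3] := uK (uE j); move=> hx c Pc.
have [Pa ea] : local_at (@emptied N.+1 n j.+1) (deg d) (a_ j).
  by apply: local_below => //=; apply: ltnSn.
have hc y : alt_poly (deg d c) (upd c (a_ j) y == occ j.+1) (x (upd c (a_ j) y)).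
  by have := hx (upd c (a_ j) y); rewrite ea; apply; apply: Pa.
have Kpos (ga al : bool) : (al <= ga)%N -> pos true (Kentry A B (u j.+1) ga al).
  by case: ga al => [] [].
have h1 : alt_poly (deg d c) false (Kentry A B (u j.+1) (c (a_ j)) true * x (upd c (a_ j) true)).
  apply: (alt_polyZ (s1 := false) _ (hc true)).
  by case: (c (a_ j)) => //=; apply: posW K3.
have h0 : alt_poly (deg d c) (upd c (a_ j) false == occ j.+1)
    (Kentry A B (u j.+1) (c (a_ j)) false * x (upd c (a_ j) false)).
  by apply: (alt_polyZ (s1 := true) _ (hc false)); apply: Kpos; case: (c _).
rewrite KopE; case: (eqVneq c _) => [cT|_].
  apply: (alt_polyD (s1 := false) (s2 := true)) => //.
  by move: h0; rewrite {2}cT upd_upd upd_same ?occ_inl // eqxx.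
by apply: (alt_polyD (s1 := false) (s2 := false)) => //; apply: alt_polyW h0.
Qed.

Lemma leading_Rop_stay k d T x a b y y' : good y y' ->
  below k a -> below k b -> a != zs -> b != zs ->
  leading_at k d T x -> leading_at k d T (Rop t a b y y' x).
Proof.
move=> yy ak bk az bz; rewrite RopE.
apply: (leading_op2 (al := T a) (be := T b)); try exact: local_below.
- by move=> *; apply: Rentry_pos.
- exact: Rentry_pos_true.
- by rewrite !upd_id.
Qed.

Lemma leading_neg_sites (j : 'I_n) d T x : leading_at j.+1 d T x ->
  leading_at j.+1 d T
    (line t (a_ j) (fun s => u j.+1 * slope u s) (inhom w) (neg_sites N.+1 n j) x).
Proof.
move=> hx; have: {subset neg_sites N.+1 n j <= neg_sites N.+1 n j} by [].
elim: {1 3}(neg_sites _ _ _) => // s l IH sub; rewrite line_cons.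
have sj := sub s (mem_head _ _).
apply: leading_Rop_stay.
- case: s {sub IH} sj => [i _|k]; first exact: uu (uE j) (uE i).
  by move=> /mapP[].
- exact: ltnSn.
- by case: s {sub IH} sj => // i; rewrite neg_sitesP => /ltnW.
- by [].
- by case: s {sub IH} sj => // k /mapP[].
- by apply: IH => r rl; apply: sub; rewrite inE rl orbT.
Qed.

Lemma occ_deposit (j : nat) (k : 'I_N.+1) : (j < size xs)%N -> nth 0%N xs j = k.+1 ->
  upd (occ j) (inr k) false = occ j.+1.
Proof.
move=> js jk; apply/ffunP => -[i|k']; rewrite updE !ffunE //.
have u_xs : uniq (drop j xs) by rewrite drop_uniq // (sorted_uniq ltn_trans ltnn).
move: u_xs; rewrite (drop_nth 0%N js) jk => /= /andP[kn _].
case: eqP => [[->]|kk]; first by rewrite (negPf kn).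
by rewrite inE eqSS; case: eqP => // e; case: kk; congr inr; apply: val_inj.
Qed.

(* A configuration reached with nonzero weight once the line W_(-(j+1)) has
   crossed W_1, ..., W_k: this line deposits its particle at x_(j+1). *)
Definition passed (j : 'I_n) (k : nat) :=
  if (j < size xs)%N && (k < nth 0%N xs j)%N then upd (occ j.+1) (a_ j) true else occ j.

Lemma passed0 (j : 'I_n) : passed j 0 = upd (occ j.+1) (a_ j) (j < size xs)%N.
Proof.
rewrite /passed; case: (ltnP j (size xs)) => [js|sj] /=.
  by have /andP[-> _] := allP xs_range _ (mem_nth 0%N js).
rewrite upd_same ?occ_inl //; apply/ffunP => -[i|k]; rewrite !ffunE //.
by rewrite !drop_oversize // ltnW.
Qed.

(** The first case is the deposit at x_(j+1) = [k.+1], realized by the entry [01|10]. *)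
Lemma passedS (j : 'I_n) (k : 'I_N.+1) :
  [/\ (j < size xs)%N, passed j k.+1 = occ j,
      upd (upd (passed j k.+1) (a_ j) true) (inr k) false = passed j k & k.+1 \in drop j xs]
  \/ passed j k.+1 = passed j k.
Proof.
rewrite /passed; case: (ltnP j (size xs)) => js /=; last by right.
case: (ltngtP k.+1 (nth 0%N xs j)) => [kx|kx|e].
- by right.
- by right.
- left; rewrite (updC _ _ _ (_ : inr k != a_ j)) // (occ_deposit js (esym e)); split=> //.
  by rewrite (drop_nth 0%N js) -e mem_head.
Qed.

Lemma leading_pos_sites (j : 'I_n) d x k : (k <= N)%N -> leading_at j.+1 d (passed j 0) x ->
  leading_at j.+1 d (passed j k)
    (line t (a_ j) (fun s => u j.+1 * slope u s) (inhom w)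
      [seq inr k | k <- rev (take k (enum 'I_N.+1))] x).
Proof.
move=> + hx; elim: k => [|k IH] kN; first by rewrite take0.
have kN1 : (k < N.+1)%N by rewrite ltnW.
pose o := Ordinal kN1.
rewrite (take_nth o) ?size_enum_ord // rev_rcons (_ : nth _ _ _ = o); last first.
  by apply: val_inj; rewrite /= nth_enum_ord.
rewrite map_cons line_cons.
have oz : inr o != zs by apply/eqP => -[] e; move: kN; rewrite e ltnn.
have gd : good (u j.+1 * slope u (inr o : S)) (inhom w (inr o : S)).
  by rewrite /= mulr1; apply: uw (uE j) _; rewrite /= kN.
have [[js e1 e2 kx]|e] := passedS j o; last first.
  rewrite -[k.+1]/(o.+1) e; apply: leading_Rop_stay => //; [exact: ltnSn|].
  exact: IH (ltnW kN).
rewrite RopE; apply: (leading_op2 (al := true) (be := false) _ _ _ _ e2).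
- by apply: local_below; first exact: ltnSn.
- exact: local_below.
- by move=> *; apply: Rentry_pos.
- apply: Rentry_pos_true => //.
  by rewrite -[k.+1]/(o.+1) e1 occ_inl occ_inr kx.
- exact: IH (ltnW kN).
Qed.

Lemma passed_last (j : 'I_n) : passed j N.+1 = occ j.
Proof.
rewrite /passed; case: ltnP => //= js.
by have /andP[_] := allP xs_range _ (mem_nth 0%N js); rewrite leqNgt => /negPf ->.
Qed.

(** Only this crossing involves [z]. For a full site, [t * (u j.+1 - z)] multiplies a component of
    formal degree one lower than the component multiplied by [(1 - t) * u j.+1], so both terms end
    with the same formal degree. *)
Lemma leading_last (j : 'I_n) d x : leading_at j.+1 d (passed j N) x ->
  leading_at j d.+1 (occ j) (Rop t (a_ j) zs (u j.+1) z x).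
Proof.
move=> hx c cj; have up := u_pos (uE j).
have ca : c (a_ j) = false by apply: cj.
have cj1 : @emptied N.+1 n j.+1 c by apply: emptiedS.
have h0 := hx c cj1.
rewrite RopRow ca /deg; case cz: (c zs) => /=; rewrite /deg cz /= ?addn0 ?addn1 in h0 *; last first.
  rewrite !upd_same //; have := alt_poly_lin (pos_free up) tpos h0.
  have [[_ _ _ zx]|e] := passedS j ord_max; last by rewrite -e passed_last.
  (* If the deposit takes place at the last site, that site is full in [occ j] but empty in [c]. *)
  have /negPf -> : c != occ j.
    by apply/eqP => e; move: zx; rewrite -(occ_inr j ord_max) -e cz.
  exact: alt_polyW.
have cup : @emptied N.+1 n j.+1 (upd (upd c (a_ j) true) zs false).
  by apply: emptied_upd => //; apply: emptied_upd => //; apply: ltnSn.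
have h1 := hx _ cup; rewrite /deg upd_eq addn1 in h1.
have f1 : alt_poly d.+1 (c == passed j N) (t * (u j.+1 - z) * x c).
  rewrite (_ : t * (u j.+1 - z) = t * u j.+1 - t * z); last by ring.
  by apply: alt_poly_lin => //; apply/(pos_free (s := true))/(posM (s1 := true) (s2 := true)).
have f2 := alt_polyZ (posM t1pos up) h1; rewrite /= in f2.
rewrite [upd (upd c _ false) _ _]upd_same; last by rewrite upd_same.
rewrite (upd_same ca).
(* The strict sign comes from the second term if the particle is deposited here, and from the first
   otherwise. *)
have [[_ e1 e2 _]|e] := passedS j ord_max; last first.
  rewrite -passed_last e -[c == _]orbF; apply: (alt_polyD f1).
  exact: alt_polyW f2.
case: (eqVneq c (occ j)) => [cE|_].
  have eN : upd (upd c (a_ j) true) zs false == passed j N.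
    by rewrite -[N]/(val (@ord_max N)) -e2 e1 cE.
  rewrite eN in f2.
  by apply: (alt_polyD (s1 := false) _ f2); apply: alt_polyW f1.
by apply: (alt_polyD (s1 := false) (s2 := false)); [apply: alt_polyW f1|apply: alt_polyW f2].
Qed.

Lemma leading_Top (j : 'I_n) d x : leading_at j.+1 d (occ j.+1) x ->
  leading_at j d.+1 (occ j) (Top t A B u w j x).
Proof.
move=> hx; rewrite TopE line_cat.
have -> : pos_sites N.+1 n = zs :: [seq inr k | k <- rev (take N (enum 'I_N.+1))].
  rewrite /pos_sites -{1}(take_size (enum 'I_N.+1)) size_enum_ord.
  rewrite (take_nth ord_max) ?size_enum_ord //.
  by rewrite rev_rcons map_cons; congr (inr _ :: _); apply: val_inj; rewrite /= nth_enum_ord.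
rewrite line_cons /= mulr1 wz; apply: leading_last; apply: leading_pos_sites => //.
by rewrite passed0; apply: leading_neg_sites; apply: leading_Kop.
Qed.

Lemma wavefunction_alt_poly :
  alt_poly (n + (N.+1 \notin xs)) true (wavefunction t A B N.+1 n u w xs).
Proof.
have h k : (k <= n)%N -> leading_at k (n - k) (occ k) (stage t A B N.+1 n u w k).
  apply: (@nat_ind_down (fun k => leading_at k _ _ _)) => {k} [c _|k kn IH].
    have -> : occ n = [ffun => false].
      by apply/ffunP => -[i|k]; rewrite !ffunE // drop_oversize.
    rewrite stage_top ffunE subnn /deg; case: eqP => [->|_] /=; last exact: alt_poly0.
    by rewrite ffunE; apply: alt_poly1.
  rewrite (stageS _ _ _ _ _ _ kn) -subnSK //.
  exact: (@leading_Top (Ordinal kn)).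
rewrite wavefunctionE; have := h 0%N (leq0n n) (occ 0).
rewrite eqxx subn0 /deg occ_inr drop0 /= /occ drop0; apply.
by move=> i _; rewrite ffunE.
Qed.

End Boundary.
End Degree.

(** * Rational functions *)

Section ProductForms.
Variables (F : fieldType) (t A B : F) (n : nat) (u w : nat -> F).

Lemma wavefunction_vacuum_prod N :
  wavefunction t A B N n u w [::]
  = \prod_(1 <= j < n.+1) (B * u j - A)
    * \prod_(1 <= j < n.+1) \prod_(1 <= k < N.+1) (u j - t * w k)
    * \prod_(1 <= k < n.+1) \prod_(1 <= j < k) (u j * u k - t).
Proof.
rewrite wavefunction_vacuum !big_split /= !big_add1 /=.
congr (_ * _ * _); apply: eq_bigr => j _; rewrite big_add1 //.
by apply: eq_bigr => i _; rewrite mulrC.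
Qed.

Lemma wavefunction_last_empty_prod N xs : N.+1 \notin xs ->
  wavefunction t A B N.+1 n u w xs
  = \prod_(1 <= j < n.+1) (u j - t * w N.+1) * wavefunction t A B N n u w xs.
Proof. by move=> h; rewrite wavefunction_last_empty // big_add1. Qed.

Hypotheses (t0 : t != 0) (un0 : u n.+1 != 0).

Lemma wavefunction_last_full_prod N xs c : c = t^-1 * u n.+1 ->
  wavefunction t A B N.+1 n.+1 u (fun k => if k == N.+1 then c else w k) (rcons xs N.+1)
  = (1 - t) * \prod_(1 <= j < n.+1) (t * u j - u n.+1)
    * \prod_(1 <= j < n.+2) (u j * u n.+1 - 1)
    * \prod_(1 <= j < N.+1) (u n.+1 - w j) * wavefunction t A B N n u w xs.
Proof.
move=> cE; rewrite wavefunction_last_full ?eqxx ?cE ?mulVKf // !big_add1 /=.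
(* The remaining factors involve only [w 1], ..., [w N], on which the modified sequence agrees with
   [w]. *)
congr (_ * _ * _); first by apply: eq_big_nat => k kN; rewrite eqSS ltn_eqF.
by apply: eq_wavefunction => // k /andP[_ kN]; rewrite ltn_eqF.
Qed.

Lemma wavefunction_one_site_full c : c = t^-1 * u n.+1 ->
  wavefunction t A B 1 n.+1 u (fun k => if k == 1%N then c else w k) [:: 1%N]
  = (1 - t) * \prod_(1 <= j < n.+1) ((t * u j - u n.+1) * (B * u j - A))
    * \prod_(1 <= j < n.+2) (u j * u n.+1 - 1)
    * \prod_(1 <= k < n.+1) \prod_(1 <= j < k) (u j * u k - t).
Proof.
(* Removing the only site leaves a lattice with N = 0, where the vacuum formula applies. *)
move=> cE; have := wavefunction_last_full_prod 0 [::] cE; rewrite /= => ->.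
rewrite [\prod_(1 <= j < 1) _]big_geq // mulr1 wavefunction_vacuum_prod big_split /=.
have -> : \prod_(1 <= j < n.+1) \prod_(1 <= k < 1) (u j - t * w k) = 1.
  by rewrite big1 // => j _; rewrite big_geq.
ring.
Qed.

Lemma wavefunction_one_site_empty :
  wavefunction t A B 1 n u w [::]
  = \prod_(1 <= j < n.+1) (B * u j - A) * \prod_(1 <= j < n.+1) (u j - t * w 1%N)
    * \prod_(1 <= k < n.+1) \prod_(1 <= j < k) (u j * u k - t).
Proof.
rewrite wavefunction_vacuum_prod; congr (_ * _ * _).
by apply: eq_bigr => j _; rewrite big_nat1.
Qed.

End ProductForms.

Import Order.TTheory Num.Theory.

(** * Rational functions with positive value at a point *)

Section Cone.
Variables (R : realType) (l : nat) (k : 'I_l) (pt : 'I_l -> R[i]).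
Implicit Types (a b : {mpoly R[i][l]}) (f g : ratfun R l).

Local Notation free := (@mpoly_free_of R l k).

Lemma free_mpolyD a b : free a -> free b -> free (a + b).
Proof. by move=> ha hb m /msuppD_le; rewrite mem_cat => /orP[/ha|/hb]. Qed.

Lemma free_mpolyN a : free a -> free (- a).
Proof. by move=> ha m; rewrite (perm_mem (msuppN a)); apply: ha. Qed.

Lemma free_mpolyM a b : free a -> free b -> free (a * b).
Proof.
move=> ha hb m /msuppM_le/allpairsP[[m1 m2] /= [/ha h1 /hb h2 ->]].
by rewrite mnmDE h1 h2.
Qed.

Lemma free_mpoly0 : free 0.
Proof. by move=> m; rewrite msupp0. Qed.

Lemma free_mpoly1 : free 1.
Proof. by move=> m; rewrite msupp1 inE => /eqP ->; rewrite mnm0E. Qed.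

Lemma free_mpolyX i : i != k -> free 'X_i.
Proof. by move=> ik m; rewrite msuppX inE => /eqP ->; rewrite mnm1E (negPf ik). Qed.

Lemma free_ratfun0 : ratfun_free_of k (0 : ratfun R l).
Proof.
exists 0, 1; split; [exact: free_mpoly0|exact: free_mpoly1|exact: oner_neq0|].
by rewrite tofrac0 mul0r.
Qed.

Lemma free_ratfunD f g : ratfun_free_of k f -> ratfun_free_of k g -> ratfun_free_of k (f + g).
Proof.
move=> [a [b [ha hb b0 ->]]] [a' [b' [ha' hb' b'0 ->]]].
have d : tofrac b != 0 by rewrite tofrac_eq0.
have d' : tofrac b' != 0 by rewrite tofrac_eq0.
exists (a * b' + a' * b), (b * b'); split.
- by apply: free_mpolyD; apply: free_mpolyM.
- exact: free_mpolyM.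
- exact: (mulf_neq0 b0 b'0).
- rewrite (tofracD (a * b')) (tofracM a) (tofracM a') (tofracM b).
  exact: (addf_div _ _ d d').
Qed.

Lemma free_ratfunN f : ratfun_free_of k f -> ratfun_free_of k (- f).
Proof.
move=> [a [b [ha hb b0 ->]]]; exists (- a), b; split=> //; first exact: free_mpolyN.
by rewrite (tofracN a); exact: (esym (mulNr _ _)).
Qed.

Lemma free_ratfunM f g : ratfun_free_of k f -> ratfun_free_of k g -> ratfun_free_of k (f * g).
Proof.
move=> [a [b [ha hb b0 ->]]] [a' [b' [ha' hb' b'0 ->]]].
exists (a * a'), (b * b'); split; try exact: free_mpolyM.
- exact: (mulf_neq0 b0 b'0).
- rewrite (tofracM a) (tofracM b); exact: mulf_div.
Qed.

(** Requiring a positive denominator keeps signs under cross multiplication. In the partial order of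
    [R[i]], being comparable with 0 includes being real. *)
Definition pos_at (s : bool) f := exists a b,
  [/\ free a, free b, 0 < b.@[pt], (if s then 0 < a.@[pt] else 0 <= a.@[pt])
    & f = tofrac a / tofrac b].

Lemma meval_gt0_neq0 b : 0 < b.@[pt] -> b != 0.
Proof. by apply: contraTneq => ->; rewrite meval0 ltxx. Qed.

Lemma pos_at_free s f : pos_at s f -> ratfun_free_of k f.
Proof.
by move=> [a [b [ha hb b0 _ ->]]]; exists a, b; split=> //; apply: meval_gt0_neq0.
Qed.

Lemma pos_at_neq0 f : pos_at true f -> f != 0.
Proof.
move=> [a [b [_ _ b0 a0 ->]]]; apply: mulf_neq0; last rewrite invr_eq0.
  by rewrite tofrac_eq0; apply: meval_gt0_neq0.
by rewrite tofrac_eq0; apply: meval_gt0_neq0.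
Qed.

Lemma pos_atW s f : pos_at s f -> pos_at false f.
Proof.
by case: s => // -[a [b [ha hb b0 a0 ->]]]; exists a, b; split=> //; apply: ltW.
Qed.

Lemma pos_at_frac a b : free a -> free b -> 0 < a.@[pt] -> 0 < b.@[pt] ->
  pos_at true (tofrac a / tofrac b).
Proof. by move=> *; exists a, b. Qed.

Lemma pos_at_tofrac a : free a -> 0 < a.@[pt] -> pos_at true (tofrac a).
Proof.
move=> ha a0; rewrite -[tofrac a]divr1 -tofrac1.
by apply: pos_at_frac => //; [exact: free_mpoly1|rewrite meval1 ltr01].
Qed.

Lemma pos_at0 : pos_at false 0.
Proof.
exists 0, 1; split; [exact: free_mpoly0|exact: free_mpoly1| | |].
- by rewrite meval1 ltr01.
- by rewrite meval0.
- by rewrite tofrac0 mul0r.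
Qed.

Lemma pos_at1 : pos_at true 1.
Proof. by rewrite -tofrac1; apply: pos_at_tofrac; [exact: free_mpoly1|rewrite meval1 ltr01]. Qed.

Lemma pos_atD s1 s2 f g : pos_at s1 f -> pos_at s2 g -> pos_at (s1 || s2) (f + g).
Proof.
move=> [a [b [ha hb b0 a0 ->]]] [a' [b' [ha' hb' b'0 a'0 ->]]].
have d : tofrac b != 0 by rewrite tofrac_eq0 meval_gt0_neq0.
have d' : tofrac b' != 0 by rewrite tofrac_eq0 meval_gt0_neq0.
exists (a * b' + a' * b), (b * b'); split.
- by apply: free_mpolyD; apply: free_mpolyM.
- exact: free_mpolyM.
- by rewrite mevalM mulr_gt0.
- rewrite mevalD !mevalM; case: s1 s2 a0 a'0 => [] [] /= a0 a'0.
  + by rewrite addr_gt0 // mulr_gt0.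
  + by rewrite ltr_wpDr ?mulr_gt0 // mulr_ge0 // ltW.
  + by rewrite ltr_wpDl ?mulr_gt0 // mulr_ge0 // ltW.
  + by rewrite addr_ge0 // mulr_ge0 // ltW.
- rewrite (tofracD (a * b')) (tofracM a) (tofracM a') (tofracM b).
  exact: (addf_div _ _ d d').
Qed.

Lemma pos_atM s1 s2 f g : pos_at s1 f -> pos_at s2 g -> pos_at (s1 && s2) (f * g).
Proof.
move=> [a [b [ha hb b0 a0 ->]]] [a' [b' [ha' hb' b'0 a'0 ->]]].
exists (a * a'), (b * b'); split; try exact: free_mpolyM.
- by rewrite mevalM mulr_gt0.
- rewrite mevalM; case: s1 s2 a0 a'0 => [] [] /= a0 a'0; first exact: mulr_gt0.
  + by rewrite mulr_ge0 // ltW.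
  + by rewrite mulr_ge0 // ltW.
  + by rewrite mulr_ge0.
- rewrite (tofracM a) (tofracM b); exact: mulf_div.
Qed.

End Cone.

(** * Nonvanishing, specialization and degree for the indeterminates *)

Section PositivePoint.
Variables (R : realType) (n N' : nat).
Local Notation N := N'.+1.
Local Notation t := (tvar R n N).
Local Notation A := (Avar R n N).
Local Notation B := (Bvar R n N).
Local Notation u := (uvar R n N).
Local Notation w := (wvar R n N).
Local Notation kN := (w_index n N N).
Local Notation ind i := (@inord (n + N).+2 i).
Local Notation X i := ('X_(ind i) : {mpoly R[i][nvars n N]}).

Let indK i : (i < nvars n N)%N -> ind i = i :> nat. Proof. exact: inordK. Qed.

Let kN_val : kN = (n + N + 2)%N :> nat.
Proof. by rewrite /w_index inordK // addn2. Qed.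

Lemma ind_neq_kN i : (i < n + N + 2)%N -> ind i != kN.
Proof.
move=> h; apply/eqP => /(congr1 val) /=; rewrite kN_val inordK; last by lia.
by move=> e; rewrite e ltnn in h.
Qed.

Lemma X_sub_X0X_neq0 i j : (i < nvars n N)%N -> (j < nvars n N)%N -> i != 0%N -> i != j ->
  X i - X 0 * X j != 0.
Proof.
(* At the point where the indeterminate [i] is 1 and all others are 0, the value is 1. *)
move=> hi hj i0 ij; have : (X i - X 0 * X j).@[fun s => (s == ind i)%:R] != 0.
  rewrite mevalB mevalM !mevalXU eqxx.
  have -> : (ind 0 == ind i) = false.
    by apply/negP => /eqP /(congr1 val) /=; rewrite !indK // => e; rewrite -e in i0.
  by rewrite mul0r subr0 oner_eq0.
by apply: contraNneq => ->; rewrite meval0.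
Qed.

Lemma var_neq0 l (i : 'I_l) : var R i != 0.
Proof.
rewrite tofrac_eq0; have : ('X_i : {mpoly R[i][l]}).@[fun=> 1] != 0 by rewrite mevalXU oner_eq0.
by apply: contraNneq => ->; rewrite meval0.
Qed.

Lemma uvar_neq0 j : u j != 0.
Proof. exact: var_neq0. Qed.

Lemma tvar_neq0 : t != 0.
Proof. exact: var_neq0. Qed.

Lemma uvar_sub_neq0 i j : (0 < i <= n)%N -> (0 < j <= n)%N -> i != j -> u i - t * u j != 0.
Proof.
move=> hi hj ij; have : tofrac (X (i + 2) - X 0 * X (j + 2)) != 0.
  by rewrite tofrac_eq0; apply: X_sub_X0X_neq0; rewrite ?eqn_add2r //; lia.
by rewrite (tofracB (X (i + 2))) (tofracM (X 0)).
Qed.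

Lemma wavefunction_subst xs c : 
  subst_eq (wavefunction t A B N n u w xs) kN c
    (wavefunction t A B N n u (fun k => if k == N then c else w k) xs).
Proof.
(* The bound covers every indeterminate except w_N, which has the last index. *)
have sub i : (i < n + N + 2)%N -> subst_eq (var R (ind i)) kN c (var R (ind i)).
  by move=> h; have := subst_var kN c (ind i); rewrite (negPf (ind_neq_kN h)).
apply: (@wavefunction_rel _ _ (fun f v => subst_eq f kN c v)).
- exact: subst0.
- exact: subst1.
- by move=> *; apply: substD.
- by move=> *; apply: substM.
- by move=> *; apply: substN.
- by apply: sub; lia.
- by apply: sub; lia.
- by apply: sub; lia.
- move=> j hj; have hu : subst_eq (u j) kN c (u j) by apply: sub; lia.
  by split; [exact: hu|exact: (substV (uvar_neq0 j) hu)].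
- move=> k hk; have := subst_var kN c (w_index n N k).
  rewrite -[var R (w_index n N k)]/(w k).
  suff -> : (w_index n N k == kN) = (k == N) by [].
  apply/eqP/eqP => [/(congr1 val) /=|-> //].
  by rewrite kN_val /w_index inordK //; lia.
Qed.

(* t = 1/2, A = -1, B = 0, u_j = 2, w_k = 1; the value of w_N is irrelevant. *)
Definition pos_point (i : 'I_(nvars n N)) : R[i] :=
  if i == 0%N :> nat then 2^-1 else if i == 1%N :> nat then -1
  else if i == 2%N :> nat then 0 else if (i <= n + 2)%N then 2 else 1.

Local Notation pt := pos_point.
Local Notation pos := (pos_at kN pt).

Let pt0 : pt (ind 0) = 2^-1. Proof. by rewrite /pt !indK. Qed.
Let pt1 : pt (ind 1) = -1. Proof. by rewrite /pt !indK. Qed.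
Let pt2 : pt (ind 2) = 0. Proof. by rewrite /pt !indK. Qed.
Let ptu j : (0 < j <= n)%N -> pt (ind (j + 2)) = 2.
Proof.
move=> hj; rewrite /pt indK; last by lia.
have [h0 h1 h2] : [/\ (j + 2 == 0)%N = false, (j + 2 == 1)%N = false & (j + 2 == 2)%N = false].
  by split; apply/negbTE; lia.
by rewrite h0 h1 h2 ifT //; lia.
Qed.
Let ptw k : (0 < k < N)%N -> pt (ind (n + k + 2)) = 1.
Proof.
move=> hk; rewrite /pt indK; last by lia.
by rewrite !ifF //; apply/negbTE; lia.
Qed.

Let freeX i : (i < n + N + 2)%N -> mpoly_free_of kN (X i).
Proof. by move=> h; apply/free_mpolyX/ind_neq_kN. Qed.

Let freeB (a b : {mpoly R[i][nvars n N]}) :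
  mpoly_free_of kN a -> mpoly_free_of kN b -> mpoly_free_of kN (a - b).
Proof. by move=> ha hb; apply: free_mpolyD => //; apply: free_mpolyN. Qed.

Let half_lt1 : 2^-1 < 1 :> R[i].
Proof. by rewrite invf_lt1 ?ltr0n // ltr1n. Qed.

Let pos_sub (a b : {mpoly R[i][nvars n N]}) :
  mpoly_free_of kN a -> mpoly_free_of kN b -> b.@[pt] < a.@[pt] ->
  pos true (tofrac a - tofrac b).
Proof.
move=> ha hb ab; rewrite -(tofracB a b); apply: pos_at_tofrac; first exact: freeB.
by rewrite mevalB subr_gt0.
Qed.

Let pos_t : pos true t.
Proof.
by apply: pos_at_tofrac; [apply: freeX; lia|rewrite mevalXU pt0 invr_gt0 ltr0n].
Qed.

Let pos_1t : pos true (1 - t).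
Proof.
rewrite -tofrac1; apply: pos_sub; [exact: free_mpoly1|apply: freeX; lia|].
by rewrite mevalXU pt0 meval1.
Qed.

Let good_pos (a b : {mpoly R[i][nvars n N]}) :
  mpoly_free_of kN a -> mpoly_free_of kN b -> 1 < a.@[pt] -> b.@[pt] = 1 ->
  good pos t (tofrac a) (tofrac b).
Proof.
move=> ha hb va vb; have a0 : 0 < a.@[pt] by apply: lt_trans va; apply: ltr01.
have f0 : mpoly_free_of kN (X 0) by apply: freeX; lia.
split.
- exact: pos_at_tofrac.
- by apply: pos_at_tofrac => //; rewrite vb ltr01.
- by apply: pos_sub => //; rewrite vb.
- rewrite -(tofracM (X 0) b); apply: pos_sub => //; first exact: free_mpolyM.
  by rewrite mevalM mevalXU pt0 vb mulr1; apply: lt_trans va.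
Qed.

Lemma wavefunction_degree xs : (0 < n)%N -> sorted ltn xs ->
  all (fun k => (1 <= k <= N)%N) xs -> (size xs <= n)%N ->
  polynomial_of_degree kN (n + (N \notin xs)).-1 (wavefunction t A B N n u w xs).
Proof.
move=> n0 xs_sorted xs_range xs_size.
have uX j : u j = tofrac (X (j + 2)) by [].
have fu j : (0 < j <= n)%N -> mpoly_free_of kN (X (j + 2)) by move=> hj; apply: freeX; lia.
have vu j : (0 < j <= n)%N -> (X (j + 2)).@[pt] = 2 by move=> hj; rewrite mevalXU ptu.
have f1 : mpoly_free_of kN (X 1) by apply: freeX; lia.
have f2 : mpoly_free_of kN (X 2) by apply: freeX; lia.
have u_pos j : (0 < j <= n)%N -> pos true (u j).
  by move=> hj; apply: pos_at_tofrac; [exact: fu|rewrite vu // ltr0n].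
(* The values at [pt] are 1, 3/2 and 1. *)
have uK j : (0 < j <= n)%N ->
    [/\ pos true (B * u j - A), pos true (u j - (u j)^-1) & pos true (B / u j - A)].
  move=> hj; have fj := fu j hj; have vj := vu j hj; split.
  - rewrite uX -(tofracM (X 2)); apply: pos_sub => //; first exact: free_mpolyM.
    by rewrite mevalM !mevalXU pt1 pt2 mul0r ltrN10.
  - have -> : u j - (u j)^-1 = tofrac (X (j + 2) * X (j + 2) - 1) / tofrac (X (j + 2)).
      rewrite (tofracB (X (j + 2) * X (j + 2))) (tofracM (X (j + 2))) tofrac1 -(uX j).
      rewrite [RHS]mulrBl mul1r; congr (_ - _).
      exact: (esym (mulfK (uvar_neq0 j) (u j))).
    apply: pos_at_frac => //; last by rewrite vj ltr0n.
      by apply: freeB; [exact: free_mpolyM|exact: free_mpoly1].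
    by rewrite mevalB mevalM vj meval1 subr_gt0 -natrM ltr1n.
  - have -> : B / u j - A = tofrac (X 2 - X 1 * X (j + 2)) / tofrac (X (j + 2)).
      rewrite (tofracB (X 2)) (tofracM (X 1)) -(uX j).
      rewrite [RHS]mulrBl; congr (_ - _).
      exact: (esym (mulfK (uvar_neq0 j) A)).
    apply: pos_at_frac => //; last by rewrite vj ltr0n.
      by apply: freeB => //; exact: free_mpolyM.
    by rewrite mevalB mevalM !mevalXU ptu // pt1 pt2 sub0r mulN1r opprK ltr0n.
have uw j k : (0 < j <= n)%N -> (0 < k <= N')%N -> good pos t (u j) (w k).
  move=> hj hk; apply: (@good_pos (X (j + 2)) (X (n + k + 2))).
  - exact: fu.
  - by apply: freeX; lia.
  - by rewrite vu // ltr1n.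
  - by rewrite mevalXU ptw //; lia.
have uu i j : (0 < i <= n)%N -> (0 < j <= n)%N -> good pos t (u i * u j) 1.
  move=> hi hj; rewrite -tofrac1 !uX -(tofracM (X (i + 2))).
  apply: good_pos; [by apply: free_mpolyM; apply: fu|exact: free_mpoly1| |exact: meval1].
  by rewrite mevalM !vu // -natrM ltr1n.
have [p [h1 h2 h3 h4]] := wavefunction_alt_poly (@free_ratfun0 _ _ kN) (@free_ratfunD _ _ kN)
  (@free_ratfunN _ _ kN) (@free_ratfunM _ _ kN) (@pos_at0 _ _ kN pt) (@pos_at1 _ _ kN pt)
  (@pos_at_free _ _ kN pt) (@pos_atW _ _ kN pt) (@pos_atD _ _ kN pt)
  (@pos_atM _ _ kN pt) pos_t pos_1t (erefl (w N)) u_pos uK uw uu xs_sorted xs_range xs_size.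
(* The size bound is positive because n is, so [.-1] is a true predecessor; the positive top
   coefficient then excludes a smaller size. *)
exists p; split=> //; have: (0 < n + (N \notin xs))%N by apply: leq_trans n0 (leq_addr _ _).
move: (n + (N \notin xs))%N h2 h3 => d h2 h3 d0.
apply/eqP; rewrite (prednK d0) eqn_leq h2 /= leqNgt; apply/negP => sp.
have := pos_at_neq0 h3; rewrite nth_default ?mulr0 ?eqxx //.
by rewrite -ltnS (prednK d0).
Qed.

End PositivePoint.

Theorem proposition4p1 (R : realType) (N n m : nat) (x : seq nat)
    (hN : (1 <= N)%N) (hn : (1 <= n)%N) (hm : (m <= minn n N)%N)
    (hsize : size x = m) (hsorted : sorted ltn x)
    (hrange : all (fun k => (1 <= k <= N)%N) x) :
  let t := tvar R n N in
  let A := Avar R n N in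
  let B := Bvar R n N in
  let u := uvar R n N in
  let w := wvar R n N in
  let W := wavefunction t A B in
  (* x_m; it is 0, hence different from N, when m = 0 *)
  let xm := last 0%N x in
  [/\ (* (1) *)
      (xm = N -> polynomial_of_degree (w_index n N N) n.-1 (W N n u w x)) /\
      (xm <> N -> polynomial_of_degree (w_index n N N) n (W N n u w x)),
      (* (2) *)
      forall s : nat -> nat,
        perm_eq [seq s j | j <- iota 1 n] (iota 1 n) ->
        W N n (fun j => u (s j)) w x = W N n u w x,
      (* (3) *)
      (2 <= N)%N ->
        (xm = N ->
           subst_eq (W N n u w x) (w_index n N N) (t^-1 * u n)
             ((1 - t) * \prod_(1 <= j < n) (t * u j - u n)
              * \prod_(1 <= j < n.+1) (u j * u n - 1)
              * \prod_(1 <= j < N) (u n - w j)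
              * W N.-1 n.-1 u w (take m.-1 x))) /\
        (xm <> N ->
           W N n u w x
           = \prod_(1 <= j < n.+1) (u j - t * w N) * W N.-1 n u w x)
    & (* (4) *)
      N = 1%N ->
        (m = 1%N ->
           subst_eq (W 1%N n u w [:: 1%N]) (w_index n N 1) (t^-1 * u n)
             ((1 - t) * \prod_(1 <= j < n) ((t * u j - u n) * (B * u j - A))
              * \prod_(1 <= j < n.+1) (u j * u n - 1)
              * \prod_(1 <= k < n) \prod_(1 <= j < k) (u j * u k - t))) /\
        (m = 0%N ->
           W 1%N n u w [::]
           = \prod_(1 <= j < n.+1) (B * u j - A)
             * \prod_(1 <= j < n.+1) (u j - t * w 1%N)
             * \prod_(1 <= k < n.+1) \prod_(1 <= j < k) (u j * u k - t))].

Proof.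
case: N hN hm hrange => [|N'] hN hm' hrange'; first by move: hN.
case: n hn hm' => [|n'] hn hm'; first by move: hn.
move=> t A B u w W xm.
have hsn : (size x <= n'.+1)%N by rewrite hsize (leq_trans hm') // geq_minl.
(* For empty [x] the default 0 of [last] differs from [N'.+1]. *)
have xmE : xm = N'.+1 -> x = rcons (take m.-1 x) N'.+1.
  rewrite /xm -hsize; case/lastP: (x) => // y z; rewrite last_rcons size_rcons /= => ->.
  by congr rcons; rewrite -cats1 take_size_cat.
(* In an increasing list only the last entry can attain the upper bound. *)
have xmN : xm <> N'.+1 -> N'.+1 \notin x.
  rewrite /xm; case/lastP: (x) hsorted hrange' => // y z.
  rewrite (sorted_pairwise ltn_trans) pairwise_rcons all_rcons last_rcons.
  move=> /andP[/allP yz _] /andP[/andP[_ zN] _] zN'.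
  have zlt : (z < N'.+1)%N by rewrite ltn_neqAle zN andbT; apply/eqP.
  rewrite mem_rcons inE negb_or gtn_eqF //=.
  by apply/negP => /yz; rewrite ltnNge (ltnW zlt).
split.
- have H := wavefunction_degree R hn hsorted hrange' hsn; split=> h.
    by move: H; rewrite (xmE h) mem_rcons mem_head addn0.
  by move: H; rewrite (xmN h) addn1.
- move=> s hs; apply: wavefunction_sym => //.
  + by move=> j _; apply: uvar_neq0.
  + by move=> i j hi hj ij; apply: uvar_sub_neq0.
- move=> N2; split=> [h|h]; last first.
    exact: (@wavefunction_last_empty_prod _ t A B n'.+1 u w N' x (xmN h)).
  have cE : t^-1 * u n'.+1 = t^-1 * u n'.+1 by [].
  have := @wavefunction_subst R n'.+1 N' x (t^-1 * u n'.+1); rewrite {2}(xmE h).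
  have t0 := tvar_neq0 R n'.+1 N'; have u0 := @uvar_neq0 R n'.+1 N'.
  by rewrite (@wavefunction_last_full_prod _ t A B n' u w t0 (u0 _) _ _ _ cE).
- move=> N1; split=> h; last exact: wavefunction_one_site_empty.
  case: N1 => N1; subst N'.
  have cE : t^-1 * u n'.+1 = t^-1 * u n'.+1 by [].
  have := @wavefunction_subst R n'.+1 0 [:: 1%N] (t^-1 * u n'.+1).
  have t0 := tvar_neq0 R n'.+1 0; have u0 := @uvar_neq0 R n'.+1 0.
  by rewrite (@wavefunction_one_site_full _ t A B n' u w t0 (u0 _) _ cE).
Qed.
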